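(* Let $\mathcal{A}$ be a von Neumann algebra on a complex Hilbert space $\mathcal{H}$, with commutant $\mathcal{A}'$. Then $\mathrm{PPU}(\mathcal{A})$, with the right-invariant lattice-order defined by the positive cone $\mathrm{PPU}^+(\mathcal{A})$, is isomorphic, in the sense of right-ordered groups (i.e. via a group isomorphism that is order-preserving in both directions), to the structure group $G(X(\mathcal{A}'))$.
   Context: Von Neumann algebra: a subalgebra $\mathcal{A}\subseteq\mathcal{B}(\mathcal{H})$, closed under adjoints, with $\mathcal{A}''=\mathcal{A}$, where $M'=\{\varphi\in\mathcal{B}(\mathcal{H}):\varphi m=m\varphi\ \forall m\in M\}$. $X(\mathcal{A}')$ is the set of closed linear subspaces $M\subseteq\mathcal{H}$ with $\mathcal{A}'M\subseteq M$, ordered by inclusion, with $M\vee N=\overline{M+N}$, $M\wedge N=M\cap N$, and $M^{\ast}$ the orthogonal complement of $M$ in $\mathcal{H}$; it is an orthomodular lattice. An orthomodular lattice (OML) is a bounded lattice $X$ with an order-reversing involution $\ast$ with $x\wedge x^{\ast}=0$, $x\vee x^{\ast}=1$, and $x\le y\Rightarrow x\vee(x^{\ast}\wedge y)=y$. Write $x\bot y$ if $y\le x^{\ast}$. The structure group $G(X)$ of an OML $X$ is the group with a map $\iota_G:X\to G(X)$ such that $\iota_G(0)=e$ and $\iota_G(x\vee y)=\iota_G(x)\iota_G(y)$ whenever $x\bot y$, and universal with this property: for each group $G$ and each map $f:X\to G$ with $f(0)=e$ and $f(x\vee y)=f(x)f(y)$ whenever $x\bot y$, there is a unique group homomorphism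 $\bar f:G(X)\to G$ with $f=\bar f\circ\iota_G$. By a theorem of Rump, the submonoid of $G(X)$ generated by $\iota_G(X)$ is the positive cone of a right lattice-order on $G(X)$; $G(X)$ is regarded as a right-ordered group with this order. A right-ordered group is a group with a partial order such that $h_1\le h_2\Rightarrow h_1g\le h_2g$. Its positive cone is $\{g: g\ge e\}$; the order defined by a positive cone $P$ is $g\ge h:\Leftrightarrow gh^{-1}\in P$. $\mathcal{A}[t,t^{-1}]$ is the ring of finite Laurent polynomials $\varphi=\sum_i t^i\varphi_i$, $\varphi_i\in\mathcal{A}$ (with $t$ central), with involution $\varphi^{\ast}=\sum_i t^{-i}\varphi_i^{\ast}$. $\mathcal{A}[t]$ is the subset with $\varphi_i=0$ for $i<0$. The pure paraunitary group is $\mathrm{PPU}(\mathcal{A})=\{\varphi\in\mathcal{A}[t,t^{-1}]:\varphi^{\ast}\varphi=\varphi\varphi^{\ast}=1,\ \sum_i\varphi_i=1\}$ under multiplication, and $\mathrm{PPU}^+(\mathcal{A})=\mathrm{PPU}(\mathcal{A})\cap\mathcal{A}[t]$. *)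

(* Defs.v *)
From HB Require Import structures.
From mathcomp Require Import all_boot all_order all_algebra finmap monalg complex.
From mathcomp Require Import all_classical all_reals topology normedtype.
From mathcomp Require Import ring lra.

Set Implicit Arguments.
Unset Strict Implicit.
Unset Printing Implicit Defensive.

Import Order.TTheory GRing.Theory Num.Theory numFieldNormedType.Exports.

Local Open Scope classical_set_scope.
Local Open Scope ring_scope.


(* The inner product is linear in the first variable and conjugate-linear in
   the second; positivity is a consequence of [dotp_norm]. *)
HB.mixin Record isHilbert (R : realType) H & CompleteNormedModule R[i] H := {
  dotp : H -> H -> R[i];
  dotp_linear : forall a x y z, dotp (a *: x + y) z = a * dotp x z + dotp y z;
  dotp_conj : forall x y, dotp y x = (dotp x y)^*;
  dotp_norm : forall x, dotp x x = `|x| ^+ 2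
}.

#[short(type="hilbertType")]
HB.structure Definition Hilbert (R : realType) :=
  {H of CompleteNormedModule R[i] H & isHilbert R H}.

Section HilbertTheory.
Variables (R : realType) (H : hilbertType R).
Implicit Types (x y z : H) (a b : R[i]).

Lemma dotpDl x y z : dotp (x + y) z = dotp x z + dotp y z.
Proof. by have := dotp_linear 1 x y z; rewrite scale1r mul1r. Qed.

Lemma dotp0l z : dotp 0 z = 0 :> R[i].
Proof.
have := dotpDl 0 0 z; rewrite addr0 => /eqP.
by rewrite -subr_eq0 opprD addNKr oppr_eq0 => /eqP.
Qed.

Lemma dotpZl a x z : dotp (a *: x) z = a * dotp x z.
Proof. by have := dotp_linear a x 0 z; rewrite addr0 dotp0l addr0. Qed.

Lemma dotpNl x z : dotp (- x) z = - dotp x z.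
Proof. by rewrite -scaleN1r dotpZl mulN1r. Qed.

Lemma dotpBl x y z : dotp (x - y) z = dotp x z - dotp y z.
Proof. by rewrite dotpDl dotpNl. Qed.

Lemma dotpDr x y z : dotp z (x + y) = dotp z x + dotp z y.
Proof. by rewrite dotp_conj dotpDl rmorphD/= -!dotp_conj. Qed.

Lemma dotpZr a x z : dotp z (a *: x) = a^* * dotp z x.
Proof. by rewrite dotp_conj dotpZl rmorphM/= -dotp_conj. Qed.

Lemma dotp0r z : dotp z 0 = 0 :> R[i].
Proof. by rewrite dotp_conj dotp0l rmorph0. Qed.

Lemma dotpNr x z : dotp z (- x) = - dotp z x.
Proof. by rewrite dotp_conj dotpNl rmorphN/= -dotp_conj. Qed.

Lemma dotpBr x y z : dotp z (x - y) = dotp z x - dotp z y.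
Proof. by rewrite dotpDr dotpNr. Qed.

Lemma dotp_eq0 x : dotp x x = 0 -> x = 0.
Proof. by rewrite dotp_norm => /eqP; rewrite expf_eq0/= normr_eq0 => /eqP. Qed.

Lemma dotp_extl x y : (forall z, dotp x z = dotp y z) -> x = y.
Proof.
by move=> e; apply/eqP; rewrite -subr_eq0; apply/eqP/dotp_eq0; rewrite dotpBl e subrr.
Qed.

Lemma dotp_extr x y : (forall z, dotp z x = dotp z y) -> x = y.
Proof. by move=> e; apply: dotp_extl => z; rewrite dotp_conj e -dotp_conj. Qed.

Lemma parallelogram x y :
  `|x + y| ^+ 2 + `|x - y| ^+ 2 = 2 * `|x| ^+ 2 + 2 * `|y| ^+ 2 :> R[i].
Proof. by rewrite -!dotp_norm !(dotpDl, dotpDr, dotpNl, dotpNr); ring. Qed.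

Lemma dotp_min z n : (forall a, `|z| <= `|z - a *: n|) -> dotp z n = 0.
Proof.
move=> zmin; have [->|n0] := eqVneq n 0; first exact: dotp0r.
have nn : dotp n n != 0 by rewrite dotp_norm expf_neq0// normr_eq0.
set c := dotp z n; have := zmin (c / dotp n n).
rewrite -(@ler_pXn2r _ 2)// ?nnegrE// -!dotp_norm.
rewrite !(dotpBl, dotpBr, dotpZl, dotpZr) rmorphM/= fmorphV/=.
rewrite -(dotp_conj n n) -/c (dotp_conj z n) -/c divfK// subrr subr0.
rewrite -subr_ge0 [X in 0 <= X](_ : _ = - (`|c| ^+ 2 / dotp n n)); last first.
  by rewrite normCK; ring.
rewrite oppr_ge0 pmulr_lle0 ?invr_gt0; last by rewrite dotp_norm exprn_gt0// normr_gt0.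
move=> h; have : `|c| ^+ 2 == 0 by rewrite eq_le h exprn_ge0.
by rewrite expf_eq0/= normr_eq0 => /eqP.
Qed.

Lemma cauchy_schwarz x y : `|dotp x y| <= `|x| * `|y|.
Proof.
have [->|y0] := eqVneq y 0; first by rewrite dotp0r !normr0 mulr0.
have yy : dotp y y != 0 by rewrite dotp_norm expf_neq0// normr_eq0.
rewrite -(@ler_pXn2r _ 2)// ?nnegrE ?mulr_ge0// exprMn -!dotp_norm.
set c := dotp x y; have := exprn_ge0 2 (normr_ge0 (x - (c / dotp y y) *: y)).
rewrite -!dotp_norm !(dotpBl, dotpBr, dotpZl, dotpZr) rmorphM/= fmorphV/=.
rewrite -(dotp_conj y y) -/c (dotp_conj x y) -/c divfK// subrr subr0 mulrAC (mulrC c^* ) -normCK.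
by rewrite subr_ge0 ler_pdivrMr// lt_def yy dotp_norm exprn_ge0.
Qed.

Definition is_subspace (M : set H) :=
  M 0 /\ forall a x y, M x -> M y -> M (a *: x + y).

Definition is_closed_subspace (M : set H) := is_subspace M /\ closed M.

Lemma closure_normP (M : set H) x :
  closure M x <-> forall e : R[i], 0 < e -> exists2 y, M y & `|x - y| < e.
Proof.
split=> [clM e e0|clM U /nbhs_ballP[e /= e0 eU]].
  by have [y [My /=]] := clM _ (nbhsx_ballx x _ e0); rewrite -ball_normE; exists y.
by have [y My xy] := clM e e0; exists y; split=> //; apply: eU; rewrite -ball_normE.
Qed.

Lemma projection_exists (M : set H) x : is_closed_subspace M ->
  exists2 p, M p & forall n, M n -> dotp (x - p) n = 0.
Proof.
move=> [[M0 Mlin] Mcl].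
pose nr z : R := complex.Re `|z|.
have nrE z : `|z| = (nr z)%:C%C by rewrite /nr RRe_real// normr_real.
have nr0 z : 0 <= nr z by rewrite -lecR -nrE; exact: normr_ge0.
have par u v : nr (u + v) ^+ 2 + nr (u - v) ^+ 2 = 2 * nr u ^+ 2 + 2 * nr v ^+ 2.
  have := parallelogram u v; rewrite !nrE -(rmorph_nat (real_complex R) 2).
  by rewrite -!rmorphXn -!rmorphM -!rmorphD => /complexI.
pose E := [set nr (x - m) | m in M].
have hE : has_inf E.
  by split; [exists (nr (x - 0)); exists 0|exists 0 => _ [m Mm <-]].
pose d := inf E.
have dle m : M m -> d <= nr (x - m) by move=> Mm; apply: ge_inf; [case: hE|exists m].
have d0 : 0 <= d by apply: lb_le_inf; [case: hE|move=> _ [m Mm <-]].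
pose B (e : R) := [set m | M m /\ nr (x - m) < d + e].
have Bne e : 0 < e -> exists m, B e m.
  by move=> e0; have [_ [m Mm <-] lt] := inf_adherent e0 hE; exists m.
pose F := filter_from [set e : R | 0 < e] B.
have FF : ProperFilter F.
  apply: filter_from_proper; last by move=> e /= /Bne.
  apply: filter_from_filter; first by exists 1 => /=.
  move=> e1 e2 /= e10 e20; exists (Num.min e1 e2); first by rewrite /= lt_min e10.
  move=> m [Mm]; rewrite -ltrBlDl lt_min => /andP[l1 l2].
  by split; split=> //; rewrite -ltrBlDl.
have Bcl e m n : B e m -> B e n -> nr (m - n) ^+ 2 <= 8 * d * e + 4 * e ^+ 2.
  move=> [Mm lm] [Mn ln].
  have Mh : M (2^-1 *: m + 2^-1 *: n).
    by apply: (Mlin) => //; rewrite -[X in M X]addr0; apply: (Mlin).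
  have := par (x - m) (x - n).
  have -> : x - m + (x - n) = (2 : R)%:C%C *: (x - (2^-1 *: m + 2^-1 *: n)).
    rewrite [(2 : R)%:C%C]rmorph_nat !scalerBr scalerDr !scalerA !divff ?pnatr_eq0//.
    by rewrite !scale1r scaler_nat mulr2n opprD addrACA.
  have -> : x - m - (x - n) = - (m - n) by rewrite !opprB addrC addrA subrK.
  have -> : nr (- (m - n)) = nr (m - n) by rewrite /nr normrN.
  have -> z : nr ((2 : R)%:C%C *: z) = 2 * nr z.
    apply: complexI; rewrite rmorphM/= -!nrE normrZ; congr (_ * _).
    by rewrite ger0_norm// lecR.
  have := dle _ Mh; have := nr0 (m - n); move: lm ln (nr0 (x - m)) (nr0 (x - n)).
  nra.
have Fc : cauchy F.
  apply/cauchy_ballP => eps eps0.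
  have epsE : eps = (complex.Re eps)%:C%C by rewrite RRe_real// gtr0_real.
  have {}eps0 : 0 < complex.Re eps by rewrite -ltcR -epsE.
  move: (complex.Re eps) epsE eps0 => {}eps -> eps0.
  pose e := Num.min 1 (eps ^+ 2 / (8 * d + 5)).
  have den : 0 < 8 * d + 5 by lra.
  have e0 : 0 < e by rewrite lt_min ltr01 divr_gt0// exprn_gt0.
  exists (B e, B e) => /=; first by split; exists e.
  move=> [m n] /= [Bm Bn]; rewrite -ball_normE /= nrE ltcR.
  rewrite -(@ltr_pXn2r _ 2)// ?nnegrE ?nr0 ?(ltW eps0)//; apply: le_lt_trans (Bcl _ _ _ Bm Bn) _.
  have e1 : e <= 1 by rewrite ge_min lexx.
  have e2 : e * (8 * d + 5) <= eps ^+ 2 by rewrite -ler_pdivlMr// ge_min lexx orbT.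
  nra.
have := @cauchy_cvg _ F FF Fc; set p := lim F => Fp.
have Fclose (eta : R) : 0 < eta -> exists2 m, B eta m & nr (p - m) < eta.
  move=> eta0.
  have : F (B eta `&` ball p eta%:C%C).
    by apply: filterI; [exists eta|apply/Fp/nbhsx_ballx; rewrite ltcR].
  by move=> /filter_ex[m [Bm]]; rewrite -ball_normE /= nrE ltcR; exists m.
have Mp : M p.
  apply/Mcl/closure_normP => eps eps0.
  have epsE : eps = (complex.Re eps)%:C%C by rewrite RRe_real// gtr0_real.
  have /Fclose[m [Mm _] lt] : 0 < complex.Re eps by rewrite -ltcR -epsE.
  by exists m => //; rewrite epsE nrE ltcR.
have pd : nr (x - p) <= d.
  apply/ler_addgt0Pr => eps eps0.
  have [m [Mm lm] pm] := Fclose (eps / 2) (divr_gt0 eps0 (ltr0n _ 2)).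
  have : nr (x - p) <= nr (x - m) + nr (p - m).
    rewrite -lecR rmorphD/= -!nrE -[X in `|X| <= _](subrKA m) -(normrN (p - m)) opprB.
    exact: ler_normD.
  lra.
exists p => // n Mn; apply: dotp_min => a.
rewrite !nrE lecR (le_trans pd)// -addrA -opprD (addrC p); apply: dle.
exact: Mlin.
Qed.

Lemma riesz (f : H -> R[i]) :
  (forall a x y, f (a *: x + y) = a * f x + f y) ->
  (exists K, forall x, `|f x| <= K * `|x|) ->
  exists y, forall x, f x = dotp x y.
Proof.
move=> flin [K fK].
have f0 : f 0 = 0.
  by have := flin (-1) 0 0; rewrite scaler0 addr0 mulN1r addNr.
have [/forallNP /= f00|] := pselect (~ exists x, f x <> 0).
  by exists 0 => x; rewrite dotp0r; apply: contrapT => /f00.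
move=> /contrapT[x0 fx0].
have fB u v : f (u - v) = f u - f v.
  by rewrite -scaleN1r addrC flin mulN1r addrC.
have kcl : is_closed_subspace [set x | f x = 0].
  split; first by split=> //= a u v fu fv; rewrite flin fu fv mulr0 addr0.
  move=> x /closure_normP kx /=; apply/eqP; rewrite -normr_eq0; apply/eqP/le_anti.
  rewrite normr_ge0 andbT; apply/ler_addgt0Pr => e e0; rewrite add0r.
  have K0 : 0 < `|K| + 1 by rewrite ltr_wpDl.
  have [y fy xy] := kx _ (divr_gt0 e0 K0).
  have -> : f x = f (x - y) by rewrite fB fy subr0.
  apply: le_trans (fK _) _; have Kr : K <= `|K| + 1.
    have : K * `|x0| \is Num.real by apply/ger0_real/(le_trans _ (fK _)).
    have x00 : `|x0| != 0 by rewrite normr_eq0; apply/eqP => xe; apply: fx0; rewrite xe.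
    by rewrite realrM ?normr_real// => /real_ler_norm le; rewrite (le_trans le)// lerDl.
  rewrite (le_trans (ler_wpM2r _ Kr))//.
  by rewrite mulrC -ler_pdivlMr// ltW.
have [p fp porth] := projection_exists x0 kcl.
set z := x0 - p; have fz : f z = f x0 by rewrite fB fp subr0.
have fz0 : f z != 0 by rewrite fz; apply/eqP.
have zz : dotp z z != 0.
  rewrite dotp_norm expf_neq0// normr_eq0; apply: contra_neq fz0 => ->.
  exact: f0.
exists ((f z / dotp z z)^* *: z) => x; rewrite dotpZr conjCK.
have : dotp z (x - (f x / f z) *: z) = 0.
  apply: porth => /=; rewrite fB -[_ *: z]addr0 flin f0 addr0.
  by rewrite divfK// subrr.
rewrite dotp_conj dotpBl dotpZl => /eqP; rewrite conjC_eq0 subr_eq0 => /eqP ->.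
by field; rewrite fz0 zz.
Qed.

End HilbertTheory.
(* B(H). The bound K is automatically real and nonnegative unless H = 0. *)
Record boundedOp (R : realType) (H : hilbertType R) := BoundedOp {
  bop_fun :> H -> H;
  bop_linear : linear bop_fun;
  bop_bounded : exists K : R[i], forall x, `|bop_fun x| <= K * `|x|
}.

HB.instance Definition _ (R : realType) (H : hilbertType R) :=
  gen_eqMixin (boundedOp H).
HB.instance Definition _ (R : realType) (H : hilbertType R) :=
  gen_choiceMixin (boundedOp H).
HB.instance Definition _ (R : realType) (H : hilbertType R) (f : boundedOp H) :=
  GRing.isLinear.Build R[i] H H *:%R f (@bop_linear R H f).

Section BoundedOp.
Variables (R : realType) (H : hilbertType R).
Implicit Types f g h : boundedOp H.

Lemma bopP f g : f =1 g <-> f = g.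
Proof.
split=> [|->//]; case: f g => [f fl fb] [g gl gb] /= /funext e.
by subst g; congr BoundedOp; exact: Prop_irrelevance.
Qed.

Lemma bop_ge0_bounded f : exists2 K : R[i], 0 <= K & forall x, `|f x| <= K * `|x|.
Proof.
have [/forallNP /= f00|/contrapT[x0 fx0]] := pselect (~ exists x, f x <> 0).
  by exists 0 => // x; rewrite mul0r (contrapT (f00 x)) normr0.
have [K fK] := bop_bounded f; exists K => //.
have x0p : 0 < `|x0|.
  by rewrite normr_gt0; apply/eqP => e; apply: fx0; rewrite e linear0.
by rewrite -(pmulr_lge0 _ x0p); apply: le_trans (fK _).
Qed.

Fact bop_zero_linear : linear (fun _ : H => 0 : H).
Proof. by move=> a x y; rewrite scaler0 addr0. Qed.
Fact bop_zero_bounded : exists K : R[i], forall x : H, `|0 : H| <= K * `|x|.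
Proof. by exists 0 => x; rewrite normr0 mul0r. Qed.
Definition bop_zero := BoundedOp bop_zero_linear bop_zero_bounded.

Fact bop_one_linear : linear (@id H). Proof. by []. Qed.
Fact bop_one_bounded : exists K : R[i], forall x : H, `|x| <= K * `|x|.
Proof. by exists 1 => x; rewrite mul1r. Qed.
Definition bop_one := BoundedOp bop_one_linear bop_one_bounded.

Fact bop_opp_linear f : linear (fun x => - f x).
Proof. by move=> a x y; rewrite linearP opprD scalerN. Qed.
Fact bop_opp_bounded f : exists K : R[i], forall x, `|- f x| <= K * `|x|.
Proof. by have [K fK] := bop_bounded f; exists K => x; rewrite normrN. Qed.
Definition bop_opp f := BoundedOp (bop_opp_linear f) (bop_opp_bounded f).

Fact bop_add_linear f g : linear (fun x => f x + g x).
Proof. by move=> a x y; rewrite !linearP scalerDr addrACA. Qed.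
Fact bop_add_bounded f g : exists K : R[i], forall x, `|f x + g x| <= K * `|x|.
Proof.
have [K fK] := bop_bounded f; have [L gL] := bop_bounded g.
by exists (K + L) => x; rewrite (le_trans (ler_normD _ _))// mulrDl lerD.
Qed.
Definition bop_add f g := BoundedOp (bop_add_linear f g) (bop_add_bounded f g).

Fact bop_scale_linear a f : linear (fun x => a *: f x).
Proof. by move=> b x y; rewrite linearP scalerDr !scalerA mulrC. Qed.
Fact bop_scale_bounded a f : exists K : R[i], forall x, `|a *: f x| <= K * `|x|.
Proof.
have [K fK] := bop_bounded f.
by exists (`|a| * K) => x; rewrite normrZ -mulrA ler_wpM2l.
Qed.
Definition bop_scale a f := BoundedOp (bop_scale_linear a f) (bop_scale_bounded a f).

Fact bop_mul_linear f g : linear (f \o g).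
Proof. by move=> a x y; rewrite /= !linearP. Qed.
Fact bop_mul_bounded f g : exists K : R[i], forall x, `|(f \o g) x| <= K * `|x|.
Proof.
have [K K0 fK] := bop_ge0_bounded f; have [L gL] := bop_bounded g.
by exists (K * L) => x; rewrite (le_trans (fK _))// -mulrA ler_wpM2l.
Qed.
Definition bop_mul f g := BoundedOp (bop_mul_linear f g) (bop_mul_bounded f g).

Fact bop_addA : associative bop_add.
Proof. by move=> f g h; apply/bopP => x /=; rewrite addrA. Qed.
Fact bop_addC : commutative bop_add.
Proof. by move=> f g; apply/bopP => x /=; rewrite addrC. Qed.
Fact bop_add0 : left_id bop_zero bop_add.
Proof. by move=> f; apply/bopP => x /=; rewrite add0r. Qed.
Fact bop_addN : left_inverse bop_zero bop_opp bop_add.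
Proof. by move=> f; apply/bopP => x /=; rewrite addNr. Qed.

HB.instance Definition _ := GRing.isZmodule.Build (boundedOp H)
  bop_addA bop_addC bop_add0 bop_addN.

Fact bop_mulA : associative bop_mul.
Proof. by move=> f g h; apply/bopP. Qed.
Fact bop_mul1 : left_id bop_one bop_mul. Proof. by move=> f; apply/bopP. Qed.
Fact bop_mulr1 : right_id bop_one bop_mul. Proof. by move=> f; apply/bopP. Qed.
Fact bop_mulDl : left_distributive bop_mul +%R.
Proof. by move=> f g h; apply/bopP. Qed.
Fact bop_mulDr : right_distributive bop_mul +%R.
Proof. by move=> f g h; apply/bopP => x /=; rewrite linearD. Qed.

(* [boundedOp H] is the zero ring when [H = 0]. *)
HB.instance Definition _ := GRing.Zmodule_isPzRing.Build (boundedOp H)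
  bop_mulA bop_mul1 bop_mulr1 bop_mulDl bop_mulDr.

Fact bop_scaleA a b f : bop_scale a (bop_scale b f) = bop_scale (a * b) f.
Proof. by apply/bopP => x /=; rewrite scalerA. Qed.
Fact bop_scale1 : left_id 1 bop_scale.
Proof. by move=> f; apply/bopP => x /=; rewrite scale1r. Qed.
Fact bop_scaleDr : right_distributive bop_scale +%R.
Proof. by move=> a f g; apply/bopP => x /=; rewrite scalerDr. Qed.
Fact bop_scaleDl f : {morph bop_scale^~ f : a b / a + b}.
Proof. by move=> a b; apply/bopP => x /=; rewrite scalerDl. Qed.

HB.instance Definition _ := GRing.Zmodule_isLmodule.Build R[i] (boundedOp H)
  bop_scaleA bop_scale1 bop_scaleDr bop_scaleDl.

Lemma bop1E x : (1 : boundedOp H) x = x. Proof. by []. Qed.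
Lemma bopME f g x : (f * g) x = f (g x). Proof. by []. Qed.
Lemma bopDE f g x : (f + g) x = f x + g x. Proof. by []. Qed.
Lemma bopZE a f x : (a *: f) x = a *: f x. Proof. by []. Qed.

Lemma adjoint_exists f :
  exists g : boundedOp H, forall x y, dotp (f x) y = dotp x (g y).
Proof.
have [K K0 fK] := bop_ge0_bounded f.
have /choice[g fg] (y : H) : exists z, forall x, dotp (f x) y = dotp x z.
  apply: riesz => [a x z|]; first by rewrite linearP dotp_linear.
  exists (K * `|y|) => x; rewrite (le_trans (cauchy_schwarz _ _))//.
  by rewrite mulrAC ler_wpM2r.
have glin : linear g.
  move=> a y z; apply: dotp_extr => x.
  by rewrite dotpDr dotpZr -!fg dotpDr dotpZr.
have gbnd : exists L : R[i], forall y, `|g y| <= L * `|y|.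
  exists K => y; have [->|gy0] := eqVneq (g y) 0.
    by rewrite normr0 mulr_ge0.
  have gyp : 0 < `|g y| by rewrite normr_gt0.
  rewrite -(ler_pM2r gyp) -expr2 -dotp_norm -fg.
  rewrite -[leLHS]ger0_norm; last by rewrite fg dotp_norm exprn_ge0.
  by rewrite (le_trans (cauchy_schwarz _ _))// mulrAC ler_wpM2r.
by exists (BoundedOp glin gbnd).
Qed.

Definition adjoint f : boundedOp H := sval (cid (adjoint_exists f)).

Lemma adjointP f x y : dotp (f x) y = dotp x (adjoint f y).
Proof. exact: svalP (cid (adjoint_exists f)) x y. Qed.

Lemma adjoint_uniq f g : (forall x y, dotp (f x) y = dotp x (g y)) -> g = adjoint f.
Proof. by move=> fg; apply/bopP => y; apply: dotp_extr => x; rewrite -fg adjointP. Qed.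

Lemma adjointK : involutive adjoint.
Proof.
move=> f; apply/esym/adjoint_uniq => x y.
by rewrite dotp_conj -adjointP -dotp_conj.
Qed.

Lemma adjoint1 : adjoint 1 = 1. Proof. exact/esym/adjoint_uniq. Qed.

Lemma adjointM f g : adjoint (f * g) = adjoint g * adjoint f.
Proof. by apply/esym/adjoint_uniq => x y; rewrite !bopME !adjointP. Qed.

Lemma adjointB : {morph adjoint : f g / f - g}.
Proof.
move=> f g; apply/esym/adjoint_uniq => x y.
by rewrite dotpBl !adjointP -dotpBr.
Qed.

HB.instance Definition _ := GRing.isZmodMorphism.Build _ _ adjoint adjointB.

Definition commutant (S : set (boundedOp H)) : set (boundedOp H) :=
  [set f | forall g, S g -> f * g = g * f].

End BoundedOp.

Record vonNeumannAlgebra (R : realType) (H : hilbertType R) := VonNeumannAlgebra {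
  vn_set :> set (boundedOp H);
  vn_zero : vn_set 0;
  vn_linear : forall (a : R[i]) f g, vn_set f -> vn_set g -> vn_set (a *: f + g);
  vn_mul : forall f g, vn_set f -> vn_set g -> vn_set (f * g);
  vn_adjoint : forall f, vn_set f -> vn_set (adjoint f);
  vn_bicommutant : commutant (commutant vn_set) = vn_set
}.

Section Commutant.
Variables (R : realType) (H : hilbertType R) (A : vonNeumannAlgebra H).

Fact commutant_zero : commutant A 0.
Proof. by move=> g _; rewrite mulr0 mul0r. Qed.

Fact commutant_linear (a : R[i]) f g :
  commutant A f -> commutant A g -> commutant A (a *: f + g).
Proof.
move=> cf cg h Ah; rewrite mulrDl mulrDr cg//; congr (_ + _).
transitivity (a *: (f * h)); first exact/bopP.
by rewrite cf//; apply/bopP => x; rewrite bopZE !bopME bopZE linearZ.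
Qed.

Fact commutant_mul f g : commutant A f -> commutant A g -> commutant A (f * g).
Proof. by move=> cf cg h Ah; rewrite -mulrA cg// mulrA cf// mulrA. Qed.

Fact commutant_adjoint f : commutant A f -> commutant A (adjoint f).
Proof.
move=> cf h Ah; have := cf _ (vn_adjoint Ah).
by move=> /(congr1 (@adjoint _ _)); rewrite !adjointM adjointK => ->.
Qed.

Fact commutant_bicommutant : commutant (commutant (commutant A)) = commutant A.
Proof. by rewrite vn_bicommutant. Qed.

Definition commutantVN : vonNeumannAlgebra H :=
  VonNeumannAlgebra commutant_zero commutant_linear commutant_mul
    commutant_adjoint commutant_bicommutant.

End Commutant.

(* X(A') is [invSubspace (commutantVN A)]. *)
Record invSubspace (R : realType) (H : hilbertType R) (N : vonNeumannAlgebra H) :=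
  InvSubspace {
    inv_set :> set H;
    inv_closed : is_closed_subspace inv_set;
    inv_invariant : forall f x, vn_set N f -> inv_set x -> inv_set (f x)
  }.

HB.instance Definition _ (R : realType) (H : hilbertType R)
  (N : vonNeumannAlgebra H) := gen_eqMixin (invSubspace N).
HB.instance Definition _ (R : realType) (H : hilbertType R)
  (N : vonNeumannAlgebra H) := gen_choiceMixin (invSubspace N).

HB.mixin Record isOrthomodular (d : Order.disp_t) X & Order.TBLattice d X := {
  ortho : X -> X;
  orthoK : involutive ortho;
  le_ortho : forall x y : X, (x <= y)%O -> (ortho y <= ortho x)%O;
  meetx_ortho : forall x : X, (x `&` ortho x)%O = \bot%O;
  joinx_ortho : forall x : X, (x `|` ortho x)%O = \top%O;
  orthomodular : forall x y : X, (x <= y)%O -> (x `|` (ortho x `&` y))%O = y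
}.

#[short(type="orthomodularType")]
HB.structure Definition Orthomodular (d : Order.disp_t) :=
  {X of Order.TBLattice d X & isOrthomodular d X}.

Section InvSubspaceLattice.
Variables (R : realType) (H : hilbertType R) (N : vonNeumannAlgebra H).
Implicit Types M L : invSubspace N.

Lemma invP M L : (forall x, inv_set M x <-> inv_set L x) -> M = L.
Proof.
case: M L => [M Mc Mi] [L Lc Li] /= e.
have {}e : M = L by apply/seteqP; split=> x /e.
by subst L; congr InvSubspace; exact: Prop_irrelevance.
Qed.

Lemma inv0 M : inv_set M 0. Proof. by case: M => M [[]]. Qed.
Lemma invL M a x y : inv_set M x -> inv_set M y -> inv_set M (a *: x + y).
Proof. by case: M => M [[M0 Ml] Mc] Mi; exact: Ml. Qed.
Lemma invZ M a x : inv_set M x -> inv_set M (a *: x).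
Proof. by move=> Mx; rewrite -[_ *: _]addr0; apply: invL => //; exact: inv0. Qed.
Lemma invD M x y : inv_set M x -> inv_set M y -> inv_set M (x + y).
Proof. by move=> Mx; rewrite -[x]scale1r; exact: invL. Qed.
Lemma invB M x y : inv_set M x -> inv_set M y -> inv_set M (x - y).
Proof. by move=> Mx My; apply: invD => //; rewrite -scaleN1r; exact: invZ. Qed.
Lemma inv_cl M : closed M. Proof. by case: M => M []. Qed.

Definition inv_le M L := `[< (M : set H) `<=` L >].

Fact inv_le_refl : reflexive inv_le. Proof. by move=> M; apply/asboolP. Qed.
Fact inv_le_anti : antisymmetric inv_le.
Proof.
by move=> M L /andP[/asboolP ML /asboolP LM]; apply: invP => x; split=> [/ML|/LM].
Qed.
Fact inv_le_trans : transitive inv_le.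
Proof.
move=> L M P /asboolP ML /asboolP LP; apply/asboolP.
exact: subset_trans ML LP.
Qed.

Fact inv_display : Order.disp_t. Proof. exact: Order.Disp tt tt. Qed.

HB.instance Definition _ := Order.isPOrder.Build inv_display (invSubspace N)
  (fun _ _ => erefl) inv_le_refl inv_le_anti inv_le_trans.

Lemma inv_leP M L : reflect ((M : set H) `<=` L) (M <= L)%O.
Proof. exact: asboolP. Qed.

Fact inv_meet_closed M L : is_closed_subspace ((M : set H) `&` L).
Proof.
split; last by apply: closedI; exact: inv_cl.
split; first by split; exact: inv0.
by move=> a x y [Mx Lx] [My Ly]; split; exact: invL.
Qed.
Fact inv_meet_inv M L f x :
  vn_set N f -> ((M : set H) `&` L) x -> ((M : set H) `&` L) (f x).
Proof. by move=> Nf [Mx Lx]; split; exact: inv_invariant. Qed.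
Definition inv_meet M L :=
  InvSubspace (inv_meet_closed M L) (@inv_meet_inv M L).

Definition sum_set (M L : set H) : set H :=
  [set z | exists x y, [/\ M x, L y & z = x + y]].

Fact inv_join_closed M L : is_closed_subspace (closure (sum_set M L)).
Proof.
split; last exact: closed_closure.
split; first by apply: subset_closure; exists 0, 0; split; rewrite ?addr0//; exact: inv0.
move=> a x y /closure_normP cx /closure_normP cy; apply/closure_normP => e e0.
have a1 : 0 < `|a| + 1 by rewrite ltr_wpDl.
have [_ [x1 [x2 [Mx1 Lx2 ->]]] dx] := cx _ (divr_gt0 (divr_gt0 e0 (ltr0n _ 2)) a1).
have [_ [y1 [y2 [My1 Ly2 ->]]] dy] := cy _ (divr_gt0 e0 (ltr0n _ 2)).
exists ((a *: x1 + y1) + (a *: x2 + y2)).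
  by exists (a *: x1 + y1), (a *: x2 + y2); split=> //; exact: invL.
have -> : a *: x + y - (a *: x1 + y1 + (a *: x2 + y2)) =
    a *: (x - (x1 + x2)) + (y - (y1 + y2)).
  by rewrite addrACA -scalerDr scalerBr opprD addrACA.
rewrite (le_lt_trans (ler_normD _ _))// normrZ [ltRHS](splitr e) ler_ltD//.
rewrite ltr_pdivlMr// in dx; apply: le_trans (ltW dx).
by rewrite mulrC ler_wpM2l// lerDl.
Qed.
Fact inv_join_inv M L f x :
  vn_set N f -> closure (sum_set M L) x -> closure (sum_set M L) (f x).
Proof.
move=> Nf /closure_normP cx; apply/closure_normP => e e0.
have [K K0 fK] := bop_ge0_bounded f.
have K1 : 0 < K + 1 by rewrite ltr_wpDl.
have [_ [y [z [My Lz ->]]] d] := cx _ (divr_gt0 e0 K1).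
exists (f y + f z); first by exists (f y), (f z); split=> //; exact: inv_invariant.
rewrite -linearD -linearB (le_lt_trans (fK _))//.
rewrite ltr_pdivlMr// in d; apply: le_lt_trans d.
by rewrite mulrC ler_wpM2l// lerDl.
Qed.
Definition inv_join M L :=
  InvSubspace (inv_join_closed M L) (@inv_join_inv M L).

Fact inv_meetP L M P : (L <= inv_meet M P)%O = (L <= M)%O && (L <= P)%O.
Proof.
apply/inv_leP/andP => [LMP|[/inv_leP LM /inv_leP LP] x Lx].
  by split; apply/inv_leP => x /LMP[].
by split; [exact: LM|exact: LP].
Qed.

Fact inv_joinP M L P : (inv_join M L <= P)%O = (M <= P)%O && (L <= P)%O.
Proof.
apply/inv_leP/andP => [MLP|[/inv_leP MP /inv_leP LP]].
  split; apply/inv_leP => x xM; apply/MLP/subset_closure.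
    by exists x, 0; split; rewrite ?addr0//; exact: inv0.
  by exists 0, x; split; rewrite ?add0r//; exact: inv0.
rewrite [X in _ `<=` X](closure_id _).1; last exact: inv_cl.
apply: closureS => _ [x [y [Mx Ly ->]]].
by apply: invD; [exact: MP|exact: LP].
Qed.

HB.instance Definition _ := Order.POrder_MeetJoin_isLattice.Build inv_display
  (invSubspace N) inv_meetP inv_joinP.

Fact inv_bot_closed : is_closed_subspace [set 0 : H].
Proof.
split; first by split=> // a x y /= -> ->; rewrite scaler0 addr0.
exact/accessible_closed_set1/hausdorff_accessible/norm_hausdorff.
Qed.
Fact inv_bot_inv (f : boundedOp H) x : vn_set N f -> [set 0 : H] x -> [set 0 : H] (f x).
Proof. by move=> _ /= ->; exact: linear0. Qed.
Definition inv_bot : invSubspace N := InvSubspace inv_bot_closed inv_bot_inv.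
Fact inv_botP M : (inv_bot <= M)%O.
Proof. by apply/inv_leP => _ /= ->; exact: inv0. Qed.
HB.instance Definition _ := Order.hasBottom.Build inv_display (invSubspace N) inv_botP.

Fact inv_top_closed : is_closed_subspace [set: H].
Proof. by split; [split|exact: closedT]. Qed.
Definition inv_top : invSubspace N := InvSubspace inv_top_closed (fun _ _ _ _ => I).
Fact inv_topP M : (M <= inv_top)%O. Proof. exact/inv_leP. Qed.
HB.instance Definition _ := Order.hasTop.Build inv_display (invSubspace N) inv_topP.

Definition ortho_set (M : set H) : set H := [set x | forall y, M y -> dotp x y = 0].

Fact inv_ortho_closed M : is_closed_subspace (ortho_set M).
Proof.
split.
  split=> [y _|a x y ox oy z Mz]; first exact: dotp0l.
  by rewrite dotp_linear ox// oy// mulr0 addr0.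
move=> x /closure_normP cx y My; apply/eqP; rewrite -normr_eq0; apply/eqP/le_anti.
rewrite normr_ge0 andbT; apply/ler_addgt0Pr => e e0; rewrite add0r.
have y1 : 0 < `|y| + 1 by rewrite ltr_wpDl.
have [z oz dz] := cx _ (divr_gt0 e0 y1).
have -> : dotp x y = dotp (x - z) y by rewrite dotpBl oz// subr0.
rewrite ltr_pdivlMr// in dz.
rewrite (le_trans (cauchy_schwarz _ _))// (le_trans _ (ltW dz))//.
by rewrite ler_wpM2l// lerDl.
Qed.
Fact inv_ortho_inv M f x : vn_set N f -> ortho_set M x -> ortho_set M (f x).
Proof.
move=> Nf ox y My; rewrite adjointP; apply: ox.
by apply: inv_invariant => //; exact: vn_adjoint.
Qed.
Definition inv_ortho M : invSubspace N :=
  InvSubspace (inv_ortho_closed M) (@inv_ortho_inv M).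

Lemma inv_projection M x : exists2 p, inv_set M p & inv_set (inv_ortho M) (x - p).
Proof. exact: projection_exists x (inv_closed M). Qed.

Fact inv_orthoK : involutive inv_ortho.
Proof.
move=> M; apply: invP => x; split=> [oox|Mx y oy]; last first.
  by rewrite dotp_conj oy// rmorph0.
have [p Mp op] := inv_projection M x.
have /dotp_eq0/eqP : dotp (x - p) (x - p) = 0.
  rewrite dotpBl (oox _ op) [X in _ - X](_ : _ = 0) ?subr0//.
  by rewrite dotp_conj op// rmorph0.
by rewrite subr_eq0 => /eqP ->.
Qed.
Fact inv_le_ortho M L : (M <= L)%O -> (inv_ortho L <= inv_ortho M)%O.
Proof. by move=> /inv_leP ML; apply/inv_leP => x ox y /ML; exact: ox. Qed.
Fact inv_meetx_ortho M : (M `&` inv_ortho M)%O = \bot%O.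
Proof.
apply: invP => x; split=> [[Mx ox]|->]; last exact: inv0.
exact/dotp_eq0/ox.
Qed.
Fact inv_joinx_ortho M : (M `|` inv_ortho M)%O = \top%O.
Proof.
apply: invP => x; split=> // _; apply: subset_closure.
have [p Mp op] := inv_projection M x.
by exists p, (x - p); split=> //; rewrite addrC subrK.
Qed.
Fact inv_orthomodular M L : (M <= L)%O -> (M `|` (inv_ortho M `&` L))%O = L.
Proof.
move=> ML; apply/le_anti; rewrite leUx ML leIr/=.
move/inv_leP : ML => ML; apply/inv_leP => x Lx; apply: subset_closure.
have [p Mp op] := inv_projection M x.
exists p, (x - p); split=> //; last by rewrite addrC subrK.
by split=> //; apply: invB => //; exact: ML.
Qed.

HB.instance Definition _ := isOrthomodular.Build inv_display (invSubspace N)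
  inv_orthoK inv_le_ortho inv_meetx_ortho inv_joinx_ortho inv_orthomodular.

End InvSubspaceLattice.
Lemma multiplicative1 (G K : groupType) (h : {multiplicative G -> K}) :
  h 1%g = 1%g.
Proof. by apply: (mulgI (h 1%g)); rewrite -gmulfM !mulg1. Qed.

Lemma multiplicativeV (G K : groupType) (h : {multiplicative G -> K}) g :
  (h g^-1 = (h g)^-1)%g.
Proof. by apply: (mulgI (h g)); rewrite -gmulfM !mulgV multiplicative1. Qed.

Section StructureGroup.
Variables (d : Order.disp_t) (X : orthomodularType d).
Local Open Scope group_scope.

Definition orth (x y : X) := (y <= ortho x)%O.

Definition orth_additive (G : groupType) (f : X -> G) :=
  f \bot%O = 1 /\ forall x y, orth x y -> f (x `|` y)%O = f x * f y.

Definition is_structure_group (G : groupType) (iota : X -> G) :=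
  orth_additive iota /\
  forall (K : groupType) (f : X -> K), orth_additive f ->
    exists2 h : {multiplicative G -> K}, f =1 h \o iota &
      forall h' : {multiplicative G -> K}, f =1 h' \o iota -> h' =1 h.

(* Existence of G(X): words in the letters x and x^-1, two words being
   identified when every [orth_additive] map to a group evaluates them alike. *)
Definition sg_word := seq (X * bool).

Definition sg_eval (K : groupType) (f : X -> K) (w : sg_word) : K :=
  foldr (fun xb k => (if xb.2 then (f xb.1)^-1 else f xb.1) * k) 1 w.

Lemma sg_eval_cat (K : groupType) (f : X -> K) w w' :
  sg_eval f (w ++ w') = sg_eval f w * sg_eval f w'.
Proof. by elim: w => [|a w IH] /=; rewrite ?mul1g// IH mulgA. Qed.

Definition sg_word_inv (w : sg_word) : sg_word :=
  rev [seq (xb.1, ~~ xb.2) | xb <- w].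

Lemma sg_eval_inv (K : groupType) (f : X -> K) w :
  sg_eval f (sg_word_inv w) = (sg_eval f w)^-1.
Proof.
elim: w => [|[x b] w IH]; first by rewrite /= invg1.
rewrite /sg_word_inv /= rev_cons -cats1 sg_eval_cat -/(sg_word_inv w) IH /=.
by rewrite mulg1 invgM; case: b; rewrite ?invgK.
Qed.

Definition sg_rel (w w' : sg_word) := `[< forall (K : groupType) (f : X -> K),
  orth_additive f -> sg_eval f w = sg_eval f w' >].

Fact sg_rel_equiv : equiv_class_of sg_rel.
Proof.
split=> [w|w w'|w' w w'']; first exact/asboolP.
  by apply: asbool_equiv_eq; split=> e K f fa; rewrite e.
move=> /asboolP e1 /asboolP e2; apply/asboolP => K f fa.
by rewrite e1// e2.
Qed.
Canonical sg_equiv := EquivRelPack sg_rel_equiv.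

Definition structure_group := {eq_quot sg_equiv}%qT.
HB.instance Definition _ := Choice.on structure_group.

Local Notation pi := (\pi_structure_group)%qT.

Definition sg_lift (K : groupType) (f : X -> K) (u : structure_group) : K :=
  sg_eval f (repr u).

Lemma sg_liftE (K : groupType) (f : X -> K) w : orth_additive f ->
  sg_lift f (pi w) = sg_eval f w.
Proof.
move=> fa; rewrite /sg_lift; case: piP => w' /eqmodP/asboolP e.
by rewrite -e.
Qed.

Lemma sgP (u v : structure_group) :
  (forall (K : groupType) (f : X -> K), orth_additive f ->
    sg_lift f u = sg_lift f v) -> u = v.
Proof. by move=> e; rewrite -[u]reprK -[v]reprK; apply/eqmodP/asboolP. Qed.

Definition sg_one : structure_group := pi [::].
Definition sg_mul (u v : structure_group) := pi (repr u ++ repr v).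
Definition sg_inv (u : structure_group) := pi (sg_word_inv (repr u)).

Lemma sg_lift1 (K : groupType) (f : X -> K) : orth_additive f -> sg_lift f sg_one = 1.
Proof. by move=> fa; rewrite sg_liftE. Qed.
Lemma sg_liftM (K : groupType) (f : X -> K) u v : orth_additive f ->
  sg_lift f (sg_mul u v) = sg_lift f u * sg_lift f v.
Proof. by move=> fa; rewrite sg_liftE// sg_eval_cat. Qed.
Lemma sg_liftV (K : groupType) (f : X -> K) u : orth_additive f ->
  sg_lift f (sg_inv u) = (sg_lift f u)^-1.
Proof. by move=> fa; rewrite sg_liftE// sg_eval_inv. Qed.

Fact sg_mulA : associative sg_mul.
Proof. by move=> u v w; apply: sgP => K f fa; rewrite !sg_liftM// mulgA. Qed.
Fact sg_mul1 : left_id sg_one sg_mul.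
Proof. by move=> u; apply: sgP => K f fa; rewrite sg_liftM// sg_lift1// mul1g. Qed.
Fact sg_mulr1 : right_id sg_one sg_mul.
Proof. by move=> u; apply: sgP => K f fa; rewrite sg_liftM// sg_lift1// mulg1. Qed.
Fact sg_mulV : left_inverse sg_one sg_inv sg_mul.
Proof.
by move=> u; apply: sgP => K f fa; rewrite sg_liftM// sg_liftV// sg_lift1// mulVg.
Qed.
Fact sg_mulrV : right_inverse sg_one sg_inv sg_mul.
Proof.
by move=> u; apply: sgP => K f fa; rewrite sg_liftM// sg_liftV// sg_lift1// mulgV.
Qed.

HB.instance Definition _ := isGroup.Build structure_group
  sg_mulA sg_mul1 sg_mulr1 sg_mulV sg_mulrV.

Definition sg_iota (x : X) : structure_group := pi [:: (x, false)].

Lemma sg_lift_iota (K : groupType) (f : X -> K) x : orth_additive f ->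
  sg_lift f (sg_iota x) = f x.
Proof. by move=> fa; rewrite sg_liftE//= mulg1. Qed.

Lemma structure_groupP : is_structure_group sg_iota.
Proof.
split.
  split=> [|x y xy]; apply: sgP => K f fa.
    by rewrite sg_lift_iota// sg_lift1//; case: fa.
  by rewrite sg_liftM// !sg_lift_iota//; case: fa => _ ->.
move=> K f fa.
have hM : {morph sg_lift f : u v / u * v} by move=> u v; rewrite sg_liftM.
pose hm := monoid.isMultiplicative.Build structure_group K (sg_lift f) hM.
pose h : {multiplicative structure_group -> K} := HB.pack (sg_lift f) hm.
exists h => [x|h' h'E u]; first by rewrite /= sg_lift_iota.
rewrite /= -[u]reprK sg_liftE//; elim: (repr u) => [|[x b] w IH] /=.
  exact: (multiplicative1 h').
rewrite -IH h'E /=; transitivity (h' ((if b then (sg_iota x)^-1 else sg_iota x) * pi w)).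
  congr (h' _); apply: sgP => L g ga.
  by rewrite sg_liftM// !sg_liftE//=; case: b; rewrite ?sg_liftV// sg_lift_iota.
by rewrite gmulfM; case: b; rewrite ?multiplicativeV.
Qed.

End StructureGroup.

Section RightOrder.
Variable G : groupType.
Local Open Scope group_scope.

(* [cone_le P g h] is g <= h in the right order with positive cone P. *)
Definition cone_le (P : set G) (g h : G) := P (h * g^-1).

Definition generated_submonoid (S : set G) : set G :=
  smallest (fun M : set G => M 1 /\ forall g h, M g -> M h -> M (g * h)) S.

Definition is_meet (le : G -> G -> Prop) (g h m : G) :=
  [/\ le m g, le m h & forall k, le k g -> le k h -> le k m].

Definition is_join (le : G -> G -> Prop) (g h j : G) :=
  [/\ le g j, le h j & forall k, le g k -> le h k -> le j k].

Record is_right_lattice_order (le : G -> G -> Prop) : Prop := {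
  rlo_refl : forall g, le g g;
  rlo_anti : forall g h, le g h -> le h g -> g = h;
  rlo_trans : forall g h k, le g h -> le h k -> le g k;
  rlo_mulr : forall g h k, le g h -> le (g * k) (h * k);
  rlo_meet : forall g h, exists m, is_meet le g h m;
  rlo_join : forall g h, exists j, is_join le g h j
}.

End RightOrder.

(* R[t, t^-1] with t central: [p@_k] is the coefficient of t^k in p and
   [<< a *g k >>] is t^k a. The library's ring structure on [{malg R[K]}] does
   not cover K = int, since it requires 0 to be the only invertible exponent. *)
Definition laurent (R : pzRingType) := {malg R[int]}.

HB.instance Definition _ (R : pzRingType) := GRing.Zmodule.on (laurent R).

Section LaurentRing.
Variable R : pzRingType.
Implicit Types p q r : laurent R.

Definition laurent_one : laurent R := << 1 *g 0 >>.

Definition laurent_mul p q : laurent R :=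
  \sum_(i <- msupp p) \sum_(j <- msupp q) << p@_i * q@_j *g i + j >>.

Lemma laurent_mulw (d1 d2 : {fset int}) p q :
  (msupp p `<=` d1)%fset -> (msupp q `<=` d2)%fset ->
  laurent_mul p q = \sum_(i <- d1) \sum_(j <- d2) << p@_i * q@_j *g i + j >>.
Proof.
move=> le1 le2; rewrite /laurent_mul (big_fset_incl _ le1) /=.
  apply/eq_bigr => i _; apply/big_fset_incl => // j _ /mcoeff_outdom ->.
  by rewrite mulr0 monalgU0.
move=> i _ /mcoeff_outdom pi.
by rewrite big1 // => j _; rewrite pi mul0r monalgU0.
Qed.

Lemma laurent_mulDl : left_distributive laurent_mul +%R.
Proof.
move=> p q r; pose s := (msupp p `|` msupp q)%fset.
rewrite (@laurent_mulw s (msupp r) (p + q)) ?msuppD_le//.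
rewrite (@laurent_mulw s (msupp r) p) ?fsubsetUl//.
rewrite (@laurent_mulw s (msupp r) q) ?fsubsetUr//.
rewrite -big_split; apply: eq_bigr => i _ /=.
rewrite -big_split; apply: eq_bigr => j _ /=.
by rewrite mcoeffD mulrDl monalgUD.
Qed.

Lemma laurent_mulDr : right_distributive laurent_mul +%R.
Proof.
move=> r p q; pose s := (msupp p `|` msupp q)%fset.
rewrite (@laurent_mulw (msupp r) s _ (p + q)) ?msuppD_le//.
rewrite (@laurent_mulw (msupp r) s _ p) ?fsubsetUl//.
rewrite (@laurent_mulw (msupp r) s _ q) ?fsubsetUr//.
rewrite -big_split; apply: eq_bigr => i _ /=.
rewrite -big_split; apply: eq_bigr => j _ /=.
by rewrite mcoeffD mulrDr monalgUD.
Qed.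

Lemma laurent_mulUU a b (i j : int) :
  laurent_mul << a *g i >> << b *g j >> = << a * b *g i + j >>.
Proof.
rewrite (@laurent_mulw [fset i]%fset [fset j]%fset) ?msuppU_le//.
by rewrite !big_seq_fset1 !mcoeffUU.
Qed.

Lemma laurent_ind (P : laurent R -> Prop) :
  P 0 -> (forall p q, P p -> P q -> P (p + q)) ->
  (forall a i, P << a *g i >>) -> forall p, P p.
Proof. by move=> P0 PD PU p; rewrite [p]monalgE; apply: big_ind => // i _. Qed.

Lemma laurent_mul0 : left_zero 0 laurent_mul.
Proof. by move=> p; rewrite /laurent_mul msupp0 big_seq_fset0. Qed.

Lemma laurent_mulr0 : right_zero 0 laurent_mul.
Proof.
by move=> p; rewrite /laurent_mul big1// => i _; rewrite msupp0 big_seq_fset0.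
Qed.

Fact laurent_mulA : associative laurent_mul.
Proof.
elim/laurent_ind => [||a i].
- by move=> q r; rewrite !laurent_mul0.
- by move=> p p' IH IH' q r; rewrite !laurent_mulDl IH IH'.
elim/laurent_ind => [||b j].
- by move=> r; rewrite laurent_mul0 laurent_mulr0 laurent_mul0.
- by move=> q q' IH IH' r; rewrite laurent_mulDr !laurent_mulDl laurent_mulDr IH IH'.
elim/laurent_ind => [||c k].
- by rewrite !laurent_mulr0.
- by move=> r r' IH IH'; rewrite !laurent_mulDr IH IH'.
by rewrite !laurent_mulUU mulrA addrA.
Qed.

Fact laurent_mul1 : left_id laurent_one laurent_mul.
Proof.
elim/laurent_ind => [|p q IH IH'|a i]; first exact: laurent_mulr0.
  by rewrite laurent_mulDr IH IH'.
by rewrite laurent_mulUU mul1r add0r.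
Qed.

Fact laurent_mulr1 : right_id laurent_one laurent_mul.
Proof.
elim/laurent_ind => [|p q IH IH'|a i]; first exact: laurent_mul0.
  by rewrite laurent_mulDl IH IH'.
by rewrite laurent_mulUU mulr1 addr0.
Qed.

HB.instance Definition _ := GRing.Zmodule_isPzRing.Build (laurent R)
  laurent_mulA laurent_mul1 laurent_mulr1 laurent_mulDl laurent_mulDr.

Lemma laurentUM a b (i j : int) :
  (<< a *g i >> : laurent R) * << b *g j >> = << a * b *g i + j >>.
Proof. exact: laurent_mulUU. Qed.

Definition laurent_sum p : R := \sum_(k <- msupp p) p@_k.

Lemma laurent_sumw (d : {fset int}) p : (msupp p `<=` d)%fset ->
  laurent_sum p = \sum_(k <- d) p@_k.
Proof.
by move=> le; rewrite /laurent_sum (big_fset_incl _ le)// => k _ /mcoeff_outdom.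
Qed.

Lemma laurent_sumD p q : laurent_sum (p + q) = laurent_sum p + laurent_sum q.
Proof.
pose s := (msupp p `|` msupp q)%fset.
rewrite (@laurent_sumw s (p + q)) ?msuppD_le// (@laurent_sumw s p) ?fsubsetUl//.
rewrite (@laurent_sumw s q) ?fsubsetUr// -big_split.
by apply: eq_bigr => k _; rewrite mcoeffD.
Qed.

Lemma laurent_sumU a (i : int) : laurent_sum << a *g i >> = a.
Proof.
by rewrite (@laurent_sumw [fset i]%fset) ?msuppU_le// big_seq_fset1 mcoeffUU.
Qed.

Lemma laurent_sum0 : laurent_sum 0 = 0.
Proof. by rewrite /laurent_sum msupp0 big_seq_fset0. Qed.

Lemma laurent_sumM p q : laurent_sum (p * q) = laurent_sum p * laurent_sum q.
Proof.
elim/laurent_ind: p q => [q|p p' IH IH' q|a i].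
- by rewrite mul0r laurent_sum0 mul0r.
- by rewrite mulrDl !laurent_sumD IH IH' mulrDl.
elim/laurent_ind => [|q q' IH IH'|b j].
- by rewrite mulr0 laurent_sum0 mulr0.
- by rewrite mulrDr !laurent_sumD IH IH' mulrDr.
by rewrite laurentUM !laurent_sumU.
Qed.

Lemma laurent_coefM p q (k : int) :
  (p * q)@_k = \sum_(i <- msupp p) \sum_(j <- msupp q) (p@_i * q@_j) *+ (i + j == k).
Proof.
rewrite [p * q]/(laurent_mul p q) raddf_sum; apply: eq_bigr => i _ /=.
by rewrite raddf_sum; apply: eq_bigr => j _ /=; rewrite mcoeffU.
Qed.

End LaurentRing.

Section LaurentStar.
Variables (R : realType) (H : hilbertType R).
Implicit Types p q : laurent (boundedOp H).

Definition laurent_star p : laurent (boundedOp H) :=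
  \sum_(k <- msupp p) << adjoint p@_k *g - k >>.

Lemma laurent_star_coef p (k : int) : (laurent_star p)@_k = adjoint p@_(- k).
Proof.
rewrite raddf_sum /=; under eq_bigr do rewrite mcoeffU eqr_oppLR.
have [kp|kp] := msuppP p (- k).
  rewrite (big_fsetD1 (- k))//= eqxx big1_fset ?addr0// => i.
  by rewrite !inE => /andP[/negbTE ->].
rewrite raddf0 big_seq big1// => i ip.
by case: eqP kp => // <-; rewrite ip.
Qed.

Lemma laurent_starD p q : laurent_star (p + q) = laurent_star p + laurent_star q.
Proof. by apply/malgP => k; rewrite !(mcoeffD, laurent_star_coef) raddfD. Qed.

Lemma laurent_star0 : laurent_star 0 = 0.
Proof. by apply/malgP => k; rewrite laurent_star_coef !mcoeff0 raddf0. Qed.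

Lemma laurent_starU a (i : int) : laurent_star << a *g i >> = << adjoint a *g - i >>.
Proof.
by apply/malgP => k; rewrite laurent_star_coef !mcoeffU raddfMn/= eqr_oppLR.
Qed.

Lemma laurent_star1 : laurent_star 1 = 1.
Proof. by rewrite laurent_starU adjoint1 oppr0. Qed.

Lemma laurent_starM p q : laurent_star (p * q) = laurent_star q * laurent_star p.
Proof.
elim/laurent_ind: p q => [q|p p' IH IH' q|a i].
- by rewrite mul0r laurent_star0 mulr0.
- by rewrite mulrDl !laurent_starD IH IH' mulrDr.
elim/laurent_ind => [|q q' IH IH'|b j].
- by rewrite mulr0 laurent_star0 mul0r.
- by rewrite mulrDr !laurent_starD IH IH' mulrDl.
by rewrite !(laurentUM, laurent_starU) adjointM opprD addrC.
Qed.

Lemma laurent_starK : involutive laurent_star.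
Proof. by move=> p; apply/malgP => k; rewrite !laurent_star_coef opprK adjointK. Qed.

Lemma laurent_sum_star p : laurent_sum (laurent_star p) = adjoint (laurent_sum p).
Proof.
elim/laurent_ind: p => [|p q IH IH'|a i].
- by rewrite laurent_star0 !laurent_sum0 raddf0.
- by rewrite laurent_starD !laurent_sumD IH IH' raddfD.
by rewrite laurent_starU !laurent_sumU.
Qed.

End LaurentStar.

Section PPU.
Variables (R : realType) (H : hilbertType R) (A : vonNeumannAlgebra H).

Definition laurent_over : set (laurent (boundedOp H)) :=
  [set p | forall k, vn_set A p@_k].

Record is_ppu (p : laurent (boundedOp H)) : Prop := {
  ppu_over : laurent_over p;
  ppu_unitary_l : laurent_star p * p = 1;
  ppu_unitary_r : p * laurent_star p = 1;
  ppu_pure : laurent_sum p = 1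
}.

Record PPU := MkPPU { ppu_val :> laurent (boundedOp H); ppuP : is_ppu ppu_val }.

HB.instance Definition _ := gen_eqMixin PPU.
HB.instance Definition _ := gen_choiceMixin PPU.

Lemma ppu_inj : injective ppu_val.
Proof.
by move=> [p pP] [q qP] /= e; subst q; congr MkPPU; exact: Prop_irrelevance.
Qed.

Lemma vnD f g : vn_set A f -> vn_set A g -> vn_set A (f + g).
Proof. by move=> Af; rewrite -[f]scale1r; exact: vn_linear. Qed.

Lemma vn1 : vn_set A 1.
Proof. by rewrite -vn_bicommutant => f _; rewrite mul1r mulr1. Qed.

Fact ppu_one_subproof : is_ppu 1.
Proof.
split; rewrite ?laurent_star1 ?mulr1//; last exact: laurent_sumU.
by move=> k; rewrite mcoeffU; case: eqP => _; [exact: vn1|exact: vn_zero].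
Qed.

Fact ppu_mul_subproof (p q : PPU) : is_ppu (ppu_val p * ppu_val q).
Proof.
case: p q => [p [pA pl pr p1]] [q [qA ql qr q1]] /=; split.
- move=> k; rewrite laurent_coefM; apply: (big_ind (vn_set A)).
  + exact: vn_zero.
  + exact: vnD.
  move=> i _; apply: (big_ind (vn_set A)); [exact: vn_zero|exact: vnD|move=> j _].
  by case: eqP => _; [exact: vn_mul|exact: vn_zero].
- by rewrite laurent_starM -mulrA (mulrA _ p) pl mul1r.
- by rewrite laurent_starM -mulrA (mulrA q) qr mul1r.
- by rewrite laurent_sumM p1 q1 mulr1.
Qed.

Fact ppu_inv_subproof (p : PPU) : is_ppu (laurent_star (ppu_val p)).
Proof.
case: p => [p [pA pl pr p1]] /=; split; rewrite ?laurent_starK//.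
  by move=> k; rewrite laurent_star_coef; exact: vn_adjoint.
by rewrite laurent_sum_star p1 adjoint1.
Qed.

Definition ppu_one := MkPPU ppu_one_subproof.
Definition ppu_mul p q := MkPPU (ppu_mul_subproof p q).
Definition ppu_inv p := MkPPU (ppu_inv_subproof p).

Fact ppu_mulA : associative ppu_mul.
Proof. by move=> p q r; apply: ppu_inj; rewrite /= mulrA. Qed.
Fact ppu_mul1 : left_id ppu_one ppu_mul.
Proof. by move=> p; apply: ppu_inj; rewrite /= mul1r. Qed.
Fact ppu_mulr1 : right_id ppu_one ppu_mul.
Proof. by move=> p; apply: ppu_inj; rewrite /= mulr1. Qed.
Fact ppu_mulV : left_inverse ppu_one ppu_inv ppu_mul.
Proof. by move=> p; apply: ppu_inj; case: p => p []. Qed.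
Fact ppu_mulrV : right_inverse ppu_one ppu_inv ppu_mul.
Proof. by move=> p; apply: ppu_inj; case: p => p []. Qed.

HB.instance Definition _ := isGroup.Build PPU
  ppu_mulA ppu_mul1 ppu_mulr1 ppu_mulV ppu_mulrV.

Definition PPU_pos : set PPU := [set p | forall k : int, k < 0 -> (ppu_val p)@_k = 0].

End PPU.

Arguments PPU_pos {R H} A _.

(* Main.v *)
From HB Require Import structures.
From mathcomp Require Import all_boot all_order all_algebra finmap monalg complex.
From mathcomp Require Import all_classical all_reals topology normedtype.
From mathcomp Require Import zify.
Require Import Defs.

(** Write [P] for the orthogonal projection onto an [A']-invariant closed
    subspace [M]; it lies in [A'' = A], and [u_M = (1 - P) + t P] is a positive
    pure paraunitary element. If [M] and [L] are orthogonal, then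
    [u_M u_L = u_(M v L)], and [u_H = t] is central. The theorem says that these
    elements generate the group and that the relations just named suffice.

    Everything rests on reading divisibility off the constant coefficient, which
    is multiplicative on the positive elements. Since [u_M^-1 = t^-1 u_N], with [N] the
    orthocomplement of [M],
    the quotient [u_M^-1 phi] of a positive [phi] is positive if and only if
    [P phi_0 = 0], that is, if [M] is contained in the kernel of the adjoint of [phi_0]. So every
    positive [phi] has a largest divisor of the form [u_M]. Splitting it off
    lowers the degree: if [phi] divides [t^(n+1)], say [phi a = t^(n+1)], then
    also [a phi = t^(n+1)], so [a_0 phi_0 = 0], and this makes the remaining
    factor of [phi] a divisor of [t^n] ([ppu_garside]).

    The rest of the isomorphism is the theory of greedy normal forms, as for
    Garside monoids, and is done for an arbitrary orthomodular lattice. Given an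
    additive map [f] into a group [K], let [E(phi)] be the product of the values
    of [f] along the greedy factorization of [phi]. The identity
    [E(u_x c) = f(x) E(c)] follows by induction on a power of [t] that both [c]
    and [u_x c] divide ([greedy_simpleM]); that power stands in for a length
    function, since chain conditions on the lattice fail in infinite dimension.
    Hence [E] is multiplicative, and it extends to the group because [t] is
    central and every element becomes positive after multiplication by a power
    of [t]. This is the universal property of the structure group
    ([garside_structure_group]), and two groups with that property are
    isomorphic over the lattice. The same factorization shows that the positive
    cone is the submonoid generated by the elements [u_M], so the isomorphism
    matches the cones.

    For the lattice order, every nonempty set [C] that is bounded below has an
    infimum. It is found by replacing the elements [x] with [c x] positive for
    all [c] in [C] by the multiples of a single element: in one step, divide by
    [u_M], where the orthocomplement of [M] is the common kernel of the constant coefficients of the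
    elements [c t^(n+1)] ([common_multiples_principal]). Meets are the infima of
    pairs, joins the infima of sets of upper bounds. *)

Set Implicit Arguments.
Unset Strict Implicit.
Unset Printing Implicit Defensive.

Import Order.TTheory GRing.Theory Num.Theory.
Local Open Scope classical_set_scope.

(** * Multiplicative maps and generated submonoids *)

Lemma multiplicativeX (G K : groupType) (h : {multiplicative G -> K}) (g : G) n :
  (h (g ^+ n) = h g ^+ n)%g.
Proof.
elim: n => [|n IH]; first exact: multiplicative1.
by rewrite !expgS gmulfM IH.
Qed.

Lemma generated_submonoid_image (G K : groupType) (h : {multiplicative G -> K})
    (S : set G) (T : set K) g : (forall x, S x -> T (h x)) ->
  generated_submonoid S g -> generated_submonoid T (h g).
Proof.
move=> ST Sg M [[M1 MM] TM]; apply: (Sg (h @^-1` M)); split=> [|x /ST/TM//].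
by split=> [|x y Mx My]; rewrite /preimage /= ?multiplicative1// gmulfM; exact: MM.
Qed.

(** * Groups of fractions of Garside monoids over an orthomodular lattice *)

Section Garside.
Variables (d : Order.disp_t) (X : orthomodularType d) (G : groupType).
Local Open Scope group_scope.

Lemma orth_additive_top (K : groupType) (f : X -> K) x : orth_additive f ->
  f \top%O = f x * f (ortho x).
Proof. by case=> _ fD; rewrite -fD ?joinx_ortho// /orth. Qed.

Lemma orth_additive_le (K : groupType) (f : X -> K) x y : orth_additive f ->
  (x <= y)%O -> f y = f x * f (ortho x `&` y)%O.
Proof. by case=> _ fD xy; rewrite -fD ?orthomodular// /orth leIl. Qed.

Lemma orth_additive_topC (K : groupType) (f : X -> K) x : orth_additive f ->
  f x * f \top%O = f \top%O * f x.
Proof.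
move=> fa; rewrite [in LHS](orth_additive_top (ortho x) fa) orthoK mulgA.
by rewrite -(orth_additive_top x fa).
Qed.

(** [P] is to be the positive cone of a right order, and [head g] the largest
    [x] such that [u x] divides [g] on the left. The last condition bounds the
    length of the factorization that takes out the largest divisor over and
    over: it is what replaces a length function. *)
Record is_garside (P : set G) (u : X -> G) (head : G -> X) : Prop := {
  cone1 : P 1;
  coneM : forall g h, P g -> P h -> P (g * h);
  cone_anti : forall g, P g -> P g^-1 -> g = 1;
  cone_cofinal : forall g, exists n, P (g * u \top%O ^+ n);
  simple_additive : orth_additive u;
  simple_pos : forall x, P (u x);
  simple_eq1 : forall x, u x = 1 -> x = \bot%O;
  topC : forall g, commute g (u \top%O);
  headP : forall g x, P g -> P ((u x)^-1 * g) <-> (x <= head g)%O;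
  tail_bounded : forall g n, P g -> P (g^-1 * u \top%O ^+ n.+1) ->
    P (((u (head g))^-1 * g)^-1 * u \top%O ^+ n)
}.

Variables (P : set G) (u : X -> G) (head : G -> X).
Hypothesis Gs : is_garside P u head.

Let t := u \top%O.
Let tail g := (u (head g))^-1 * g.
(** For Laurent polynomials, [P (g^-1 * t ^+ n)] says that the degree of [g] is
    at most [n]. *)
Let divides n g := P g /\ P (g^-1 * t ^+ n).

Lemma topXC g n : g * t ^+ n = t ^+ n * g.
Proof. exact: commuteX (topC Gs g). Qed.

Lemma divides0 g : divides 0 g -> g = 1.
Proof. by case=> Pg; rewrite mulg1; exact: (cone_anti Gs). Qed.

Lemma divides1 : divides 0 1.
Proof. by split; rewrite ?invg1 ?mulg1; exact: (cone1 Gs). Qed.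

Lemma dividesS n g : divides n g -> divides n.+1 g.
Proof.
case=> Pg Pt; split=> //; rewrite expgSr mulgA; apply: (coneM Gs) => //.
exact: (simple_pos Gs).
Qed.

Lemma dividesM n m g h : divides n g -> divides m h -> divides (n + m) (g * h).
Proof.
move=> [Pg Pgt] [Ph Pht]; split; first exact: (coneM Gs).
by rewrite expgnDr invgM -mulgA (mulgA g^-1) topXC mulgA; apply: (coneM Gs).
Qed.

Lemma divides_simple x : divides 1 (u x).
Proof.
split; first exact: (simple_pos Gs).
rewrite expg1 /t (orth_additive_top x (simple_additive Gs)) mulKg.
exact: (simple_pos Gs).
Qed.

Lemma divides_topX n : divides n (t ^+ n).
Proof.
elim: n => [|n IH]; first exact: divides1.
by rewrite expgSr -addn1; apply: dividesM => //; exact: divides_simple.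
Qed.

Lemma divides_bounded g : exists nm, divides nm.2 (g * t ^+ nm.1).
Proof.
have [n Pn] := cone_cofinal Gs g; have [m Pm] := cone_cofinal Gs g^-1.
exists (n, n + m); split=> //=.
by rewrite expgnDr topXC invgM mulgA mulgVK.
Qed.

Lemma divides_tail n g : divides n.+1 g -> divides n (tail g).
Proof.
by move=> [Pg Pt]; split; [apply/(headP Gs)|exact: (tail_bounded Gs)].
Qed.

Lemma head1 : head 1 = \bot%O.
Proof.
apply: (simple_eq1 Gs); apply: (cone_anti Gs); first exact: (simple_pos Gs).
by rewrite -[_^-1]mulg1; apply/(headP Gs) => //; exact: (cone1 Gs).
Qed.

Lemma tail1 : tail 1 = 1.
Proof. by rewrite /tail head1 mulg1 (simple_additive Gs).1 invg1. Qed.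

Lemma tailK g : u (head g) * tail g = g.
Proof. exact: mulVKg. Qed.

(** Every [g] that divides some [t ^+ n] is a product of [n] elements [u x]. *)
Lemma garside_ind (Q : G -> Prop) :
  Q 1 -> (forall x g, Q g -> Q (u x * g)) -> forall n g, divides n g -> Q g.
Proof.
move=> Q1 QM; elim=> [|n IH] g; first by move=> /divides0 ->.
by move=> /divides_tail/IH/(QM (head g)); rewrite tailK.
Qed.

(** An element [g] of the cone divides some [t ^+ n], because [g^-1] becomes
    positive after multiplication by a power of [t]. *)
Lemma garside_cone_generated : P = generated_submonoid (range u).
Proof.
apply/seteqP; split=> [g Pg S [[S1 SM] Su]|]; last first.
  apply: smallest_sub; last by move=> _ [x _ <-]; exact: (simple_pos Gs).
  by split; [exact: (cone1 Gs)|exact: (coneM Gs)].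
have [n Pn] := cone_cofinal Gs g^-1.
apply: (garside_ind (Q := S)) (conj Pg Pn) => // x h Sh.
by apply: SM => //; apply: Su; exists x.
Qed.

Section Extension.
Variables (K : groupType) (f : X -> K).
Hypothesis fa : orth_additive f.

(** The product of the values of [f] along the first [n] steps of the greedy
    factorization of [g]; it is meant for [g] with [divides n g], where these
    steps exhaust [g]. *)
Fixpoint greedy n g : K := if n is m.+1 then f (head g) * greedy m (tail g) else 1.

(** Both sides are cut down to the same remainder [h], the tail of [u x * g]. Its
    head is [y >= x], and [y] splits orthogonally into [x] and [z], so that
    [u z] is what remains to be divided out of [g]. Then [z <= head g], and
    [head g] splits into [z] and [w], so that [h = u w * tail g]. The induction
    hypothesis applied to this product closes the square. *)
Lemma greedy_simpleM n x g : divides n g -> divides n (u x * g) ->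
  greedy n (u x * g) = f x * greedy n g.
Proof.
elim: n x g => [|n IH] x g dg dxg /=.
  have gE := divides0 dg; have := divides0 dxg; rewrite gE mulg1 => /(simple_eq1 Gs) ->.
  by rewrite fa.1 mulg1.
set y := head (u x * g).
have xy : (x <= y)%O by apply/(headP Gs); [case: dxg|rewrite mulKg; case: dg].
rewrite (orth_additive_le fa xy) -mulgA; congr (_ * _).
set z := (ortho x `&` y)%O; set h := tail (u x * g).
have hE : h = (u z)^-1 * g.
  by rewrite /h /tail -/y (orth_additive_le (simple_additive Gs) xy) -/z invgM -mulgA mulKg.
have dh : divides n h by exact: divides_tail.
have zg : (z <= head g)%O by apply/(headP Gs); rewrite -?hE; [case: dg|case: dh].
rewrite (orth_additive_le fa zg) -mulgA; congr (_ * _).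
set w := (ortho z `&` head g)%O.
have hw : h = u w * tail g.
  rewrite hE /tail (orth_additive_le (simple_additive Gs) zg) -/w invgM.
  by rewrite -[in RHS]mulgA mulVKg.
by rewrite hw IH -?hw//; exact: divides_tail.
Qed.

Lemma greedyW n m g : divides n g -> (n <= m)%N -> greedy m g = greedy n g.
Proof.
elim: n m g => [|n IH] m g dg.
  move=> _; rewrite (divides0 dg) /=; elim: m => //= m IHm.
  by rewrite tail1 IHm head1 fa.1 mulg1.
by case: m => // m nm /=; rewrite IH//; exact: divides_tail.
Qed.

Lemma greedy_indep n m g : divides n g -> divides m g -> greedy n g = greedy m g.
Proof.
by move=> dn dm; rewrite -(greedyW dn (leq_maxl n m)) -(greedyW dm (leq_maxr n m)).
Qed.

Lemma greedyM n m g h : divides n g -> divides m h ->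
  greedy (n + m) (g * h) = greedy n g * greedy m h.
Proof.
move=> dg dh; elim: n g dg => [|n IH] g dg.
  by rewrite (divides0 dg) !mul1g.
have dg' := divides_tail dg; have dgh := dividesM dg' dh.
rewrite -{1}(tailK g) -mulgA greedy_simpleM.
- by rewrite (greedyW dgh) ?addSn// IH// mulgA.
- by rewrite addSn; exact: dividesS.
- by rewrite mulgA tailK; exact: dividesM.
Qed.

Lemma greedy_simple x : greedy 1 (u x) = f x.
Proof.
have := @greedy_simpleM 1 x 1 (dividesS divides1).
by rewrite mulg1 => ->; [rewrite (greedyW divides1)//= mulg1|exact: divides_simple].
Qed.

Lemma greedy_topX n : greedy n (t ^+ n) = f \top%O ^+ n.
Proof.
elim: n => [//|n IH].
rewrite !expgSr -{1}addn1 greedyM ?IH ?greedy_simple//; first exact: divides_topX.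
exact: divides_simple.
Qed.

(** [f \top] commutes with every [f x], since [f x * f (ortho x)] and
    [f (ortho x) * f x] both equal [f \top]. *)
Lemma greedy_topC n g : commute (greedy n g) (f \top%O).
Proof.
elim: n g => [|n IH] g /=; first exact/commute_sym/commute1.
by apply/commute_sym/commuteM; apply/commute_sym => //; exact: orth_additive_topC.
Qed.

(** Elements of the group are fractions [k * t ^- n] with [k] in the cone; the
    fraction is chosen arbitrarily, and [extensionE] shows that any other one
    gives the same value. *)
Definition extension g : K :=
  let nm := sval (cid (divides_bounded g)) in
  greedy nm.2 (g * t ^+ nm.1) * f \top%O ^- nm.1.

Lemma extensionE n m g : divides m (g * t ^+ n) ->
  extension g = greedy m (g * t ^+ n) * f \top%O ^- n.
Proof.
rewrite /extension; case: (cid _) => -[n' m'] /= dg' dg.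
apply: (mulIg (f \top%O ^+ (n + n'))).
rewrite {1}addnC !expgnDr !mulgA !mulgVK -!greedy_topX -!greedyM//; try exact: divides_topX.
rewrite -!mulgA -!expgnDr (addnC n'); apply: greedy_indep.
  by rewrite (addnC n) expgnDr mulgA; apply: dividesM => //; exact: divides_topX.
by rewrite expgnDr mulgA; apply: dividesM => //; exact: divides_topX.
Qed.

Lemma extensionM : {morph extension : g h / g * h}.
Proof.
move=> g h; have [[n n'] /= dg] := divides_bounded g.
have [[m m'] /= dh] := divides_bounded h.
have ghE : g * h * t ^+ (n + m) = (g * t ^+ n) * (h * t ^+ m).
  by rewrite expgnDr !mulgA -(mulgA g h) (topXC h n) !mulgA.
rewrite (extensionE dg) (extensionE dh) (extensionE (n := n + m) (m := n' + m')).
  rewrite ghE greedyM// (addnC n) expgnDr invgM !mulgA; congr (_ * _).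
  rewrite -!mulgA; congr (_ * _).
  by apply/commuteV/commuteX/greedy_topC.
by rewrite ghE; exact: dividesM.
Qed.

Lemma extension_simple x : extension (u x) = f x.
Proof.
have du : divides 1 (u x * t ^+ 0) by rewrite mulg1; exact: divides_simple.
by rewrite (extensionE du) !mulg1 greedy_simple invg1 mulg1.
Qed.

Lemma extension_unique (h1 h2 : {multiplicative G -> K}) :
  (forall x, h1 (u x) = h2 (u x)) -> h1 =1 h2.
Proof.
move=> e g; have [[n m] /= dg] := divides_bounded g.
have E k : divides m k -> h1 k = h2 k.
  move=> dk; apply: (garside_ind (Q := fun k => h1 k = h2 k)) dk.
    by rewrite !multiplicative1.
  by move=> x l el; rewrite !gmulfM el (e x).
apply: (mulIg (h1 t ^+ n)).
by rewrite {2}(e \top%O) -!multiplicativeX -!gmulfM E.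
Qed.

End Extension.

(** Existence in the universal property is [extension]; uniqueness holds because
    the elements [u x] generate the group. *)
Theorem garside_structure_group : is_structure_group u.
Proof.
split=> [|K f fa]; first exact: simple_additive Gs.
pose m := monoid.isMultiplicative.Build G K (extension f) (extensionM fa).
pose h : {multiplicative G -> K} := HB.pack (extension f) m.
exists h => [x|h' h'E]; first by rewrite /= extension_simple.
by apply: extension_unique => x; rewrite -[LHS]h'E /= extension_simple.
Qed.

End Garside.

Lemma structure_group_iso (d : Order.disp_t) (X : orthomodularType d)
    (G K : groupType) (u : X -> G) (v : X -> K) :
  is_structure_group u -> is_structure_group v ->
  exists f : {multiplicative G -> K}, exists g : {multiplicative K -> G},
    [/\ cancel f g, cancel g f & f \o u =1 v].
Proof.
move=> [ua uP] [va vP]; have [f fu _] := uP _ _ va; have [g gv _] := vP _ _ ua.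
have idP (L : groupType) (w : X -> L) (k : {multiplicative L -> L}) :
    is_structure_group w -> w =1 k \o w -> k =1 id.
  move=> [wa wP] kw y; have [h _ hU] := wP _ _ wa.
  by rewrite (hU k kw) -(hU idfun (fun _ => erefl)).
exists f, g; split=> [||x]; last by rewrite -fu.
  by apply: (idP _ u (g \o f)) => // x; rewrite /= -[f _]fu -[RHS]gv.
by apply: (idP _ v (f \o g)) => // x; rewrite /= -[g _]gv -[RHS]fu.
Qed.

Local Open Scope ring_scope.

(** * Orthogonal projections onto invariant subspaces *)

Section Projection.
Variables (R : realType) (H : hilbertType R) (N : vonNeumannAlgebra H).
Implicit Types (M L : invSubspace N) (x y p : H) (f : boundedOp H).

Definition proj_fun M x : H := s2val (cid2 (inv_projection M x)).

Lemma proj_funP M x : inv_set M (proj_fun M x) /\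
  inv_set (inv_ortho M) (x - proj_fun M x).
Proof. by split; rewrite /proj_fun; case: (cid2 _). Qed.

Lemma proj_fun_uniq M x p :
  inv_set M p -> inv_set (inv_ortho M) (x - p) -> proj_fun M x = p.
Proof.
move=> Mp op; have [Mq oq] := proj_funP M x.
apply/eqP; rewrite -subr_eq0; apply/eqP/dotp_eq0.
have := @invB _ _ _ (inv_ortho M) _ _ op oq; rewrite opprB addrC addrA subrK.
by apply; exact: invB.
Qed.

Fact proj_fun_linear M : linear (proj_fun M).
Proof.
move=> a x y; have [Mx ox] := proj_funP M x; have [My oy] := proj_funP M y.
apply: proj_fun_uniq; first exact: invL.
rewrite opprD addrACA -scalerBr; exact: (@invL _ _ _ (inv_ortho M)).
Qed.

(** In both arguments the component in the orthocomplement of [M] drops out. *)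
Lemma proj_fun_sa M x y : dotp (proj_fun M x) y = dotp x (proj_fun M y).
Proof.
have [Mx ox] := proj_funP M x; have [My oy] := proj_funP M y.
rewrite -[y in LHS](subrK (proj_fun M y)) dotpDr [X in X + _]dotp_conj (oy _ Mx) rmorph0 add0r.
by rewrite -[x in RHS](subrK (proj_fun M x)) dotpDl (ox _ My) add0r.
Qed.

Fact proj_fun_bounded M : exists K : R[i], forall x, `|proj_fun M x| <= K * `|x|.
Proof.
exists 1 => x; rewrite mul1r.
have [->|p0] := eqVneq (proj_fun M x) 0; first by rewrite normr0.
have pp : 0 < `|proj_fun M x| by rewrite normr_gt0.
have [Mx ox] := proj_funP M x.
have idp : proj_fun M (proj_fun M x) = proj_fun M x.
  by apply: proj_fun_uniq => //; rewrite subrr; exact: inv0.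
rewrite -(ler_pM2r pp) -expr2 -dotp_norm -[leLHS]ger0_norm.
  by rewrite proj_fun_sa idp cauchy_schwarz.
by rewrite dotp_norm exprn_ge0.
Qed.

Definition proj M : boundedOp H := BoundedOp (@proj_fun_linear M) (proj_fun_bounded M).

Lemma proj_mem M x : inv_set M (proj M x).
Proof. by have [] := proj_funP M x. Qed.

Lemma proj_uniq M x p :
  inv_set M p -> inv_set (inv_ortho M) (x - p) -> proj M x = p.
Proof. exact: proj_fun_uniq. Qed.

Lemma proj_id M x : inv_set M x -> proj M x = x.
Proof. by move=> Mx; apply: proj_uniq => //; rewrite subrr; exact: inv0. Qed.

Lemma proj_adjoint M : adjoint (proj M) = proj M.
Proof. by apply/esym/adjoint_uniq => x y; exact: proj_fun_sa. Qed.

Lemma proj_comm M f : vn_set N f -> proj M * f = f * proj M.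
Proof.
move=> Nf; apply/bopP => x; rewrite !bopME.
have [Mx ox] := proj_funP M x; apply: proj_uniq; first exact: inv_invariant.
by rewrite -linearB; exact: (@inv_invariant _ _ _ (inv_ortho M)).
Qed.

Lemma projMl M f : (forall x, inv_set M (f x)) -> proj M * f = f.
Proof. by move=> Mf; apply/bopP => x; rewrite bopME proj_id. Qed.

Lemma projK M : proj M * proj M = proj M.
Proof. by apply: projMl; exact: proj_mem. Qed.

Lemma proj_ortho M : proj (ortho M) = 1 - proj M.
Proof.
apply/bopP => x; have [Mx ox] := proj_funP M x.
apply: proj_uniq => // y oy; rewrite opprB addrC subrK dotp_conj oy ?rmorph0//.
Qed.

Lemma proj_bot : proj (\bot%O : invSubspace N) = 0.
Proof. by apply/bopP => x; exact: (proj_mem (\bot%O : invSubspace N) x). Qed.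

Lemma proj_top : proj (\top%O : invSubspace N) = 1.
Proof. by apply/bopP => x; apply: proj_id. Qed.

(** The residual [x - (proj M x + proj L x)] is orthogonal to both [M] and [L];
    that it is orthogonal to the closure of their sum is De Morgan's law, which
    replaces an argument by continuity. *)
Lemma proj_join M L : orth M L -> proj (M `|` L)%O = proj M + proj L.
Proof.
move=> /inv_leP LM; apply/bopP => x.
have [Mx ox] := proj_funP M x; have [Lx oLx] := proj_funP L x.
apply: proj_uniq; first by apply: subset_closure; exists (proj M x), (proj L x).
set z := x - _; pose I := (ortho M `&` ortho L)%O.
have MI : (M `|` L <= ortho I)%O.
  by rewrite leUx -[X in (X <= _)%O && _]orthoK -[X in _ && (X <= _)%O]orthoK !le_ortho ?leIl ?leIr.
have Iz : inv_set I z.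
  split; rewrite /z /= ?opprD ?addrA.
    by apply: (@invB _ _ _ (inv_ortho M)) => //; exact: LM.
  rewrite addrAC; apply: (@invB _ _ _ (inv_ortho L)) => // y Ly.
  by rewrite dotp_conj (LM _ Ly) ?rmorph0.
by move=> y /(inv_leP _ _ MI) oy; rewrite dotp_conj (oy _ Iz) rmorph0.
Qed.

Lemma proj_orth M L : orth M L -> proj M * proj L = 0.
Proof.
move=> /inv_leP LM; apply/bopP => x; apply: proj_uniq; first exact: inv0.
by rewrite subr0; apply: LM; exact: proj_mem.
Qed.

Lemma proj_inj0 M : proj M = 0 -> M = \bot%O.
Proof.
move=> M0; apply: invP => x; split=> [Mx|->]; last exact: inv0.
by rewrite -(proj_id Mx) M0.
Qed.

End Projection.

(** * Common kernels of operators in the algebra *)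

Section Nullspace.
Variables (R : realType) (H : hilbertType R) (A : vonNeumannAlgebra H).
Implicit Types (S : set (boundedOp H)) (M : invSubspace (commutantVN A)).

(** Where the bicommutant condition enters: projections onto [A']-invariant
    subspaces commute with [A'], hence belong to [A'' = A]. *)
Lemma proj_vn M : vn_set A (proj M).
Proof. by rewrite -vn_bicommutant => f cf; exact: proj_comm. Qed.

(** The restriction to elements of [A] makes the common kernel
    [A']-invariant for every set [S]. *)
Definition null_set S : set H := [set x | forall c, S c -> vn_set A c -> c x = 0].

Fact null_set_closed S : is_closed_subspace (null_set S).
Proof.
split.
  split=> [c _ _|a x y nx ny c Sc Ac]; first exact: linear0.
  by rewrite bop_linear (nx c Sc Ac) (ny c Sc Ac) scaler0 addr0.
move=> x /closure_normP cx c Sc Ac; apply/eqP; rewrite -normr_eq0; apply/eqP/le_anti.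
rewrite normr_ge0 andbT; apply/ler_addgt0Pr => e e0; rewrite add0r.
have [K K0 cK] := bop_ge0_bounded c; have K1 : 0 < K + 1 by rewrite ltr_wpDl.
have [z nz dz] := cx _ (divr_gt0 e0 K1).
have -> : c x = c (x - z).
  have -> : c (x - z) = c x - c z by exact: linearB.
  by rewrite (nz c Sc Ac) subr0.
rewrite ltr_pdivlMr// in dz.
by rewrite (le_trans (cK _))// (le_trans _ (ltW dz))// mulrC ler_wpM2l// lerDl.
Qed.

Fact null_set_inv S f x : vn_set (commutantVN A) f -> null_set S x -> null_set S (f x).
Proof. by move=> cf nx c Sc Ac; rewrite -bopME -cf// bopME nx// linear0. Qed.

Definition nullspace S : invSubspace (commutantVN A) :=
  InvSubspace (null_set_closed S) (@null_set_inv S).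

Lemma mul_proj_nullspace S c : S c -> vn_set A c -> c * proj (nullspace S) = 0.
Proof. by move=> Sc Ac; apply/bopP => x; exact: (proj_mem (nullspace S) x). Qed.

Lemma proj_nullspace_mul S b : (forall c, S c -> vn_set A c -> c * b = 0) ->
  proj (nullspace S) * b = b.
Proof. by move=> Sb; apply: projMl => x c Sc Ac; rewrite -bopME Sb. Qed.

(** The kernel of [adjoint a] is the orthocomplement of the range of [a], so it
    contains the subspaces orthogonal to that range. *)
Lemma le_nullspace1 a M : vn_set A a ->
  (M <= nullspace [set adjoint a])%O <-> proj M * a = 0.
Proof.
move=> Aa; split=> [/inv_leP Mn|Ma].
  apply: (can_inj (@adjointK _ _)); rewrite adjointM proj_adjoint raddf0.
  apply/bopP => x; rewrite bopME; apply: (Mn _ (proj_mem M x)) => //.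
  exact: vn_adjoint.
apply/inv_leP => x Mx c -> _.
by rewrite -(proj_id Mx) -bopME -[proj M]proj_adjoint -adjointM Ma raddf0.
Qed.

End Nullspace.

(** * Positivity and the constant coefficient of Laurent polynomials *)

Notation mono a i := (<< a *g i >> : laurent _) (only parsing).

Section LaurentCoef.
Variable R : pzRingType.
Implicit Types (p q : laurent R) (a : R) (i k : int).

Lemma laurentU_coefl a i p k : (mono a i * p)@_k = a * p@_(k - i).
Proof.
elim/laurent_ind: p => [|p q IH IH'|b j].
- by rewrite mulr0 !mcoeff0 mulr0.
- by rewrite mulrDr !mcoeffD IH IH' mulrDr.
by rewrite laurentUM !mcoeffU mulrnAr addrC [in RHS]eq_sym subr_eq [in LHS]eq_sym.
Qed.

Lemma laurentU_coefr a i p k : (p * mono a i)@_k = p@_(k - i) * a.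
Proof.
elim/laurent_ind: p => [|p q IH IH'|b j].
- by rewrite mul0r !mcoeff0 mul0r.
- by rewrite mulrDl !mcoeffD IH IH' mulrDl.
by rewrite laurentUM !mcoeffU mulrnAl [in RHS]eq_sym subr_eq [in LHS]eq_sym.
Qed.

Definition laurent_pos p := forall k, k < 0 -> p@_k = 0.

Lemma laurent_posM p q : laurent_pos p -> laurent_pos q -> laurent_pos (p * q).
Proof.
move=> pp pq k k0; rewrite laurent_coefM big1// => i _; rewrite big1// => j _.
case: eqP => // ij; have [i0|i0] := ltP i 0; first by rewrite pp// mul0r.
have [j0|j0] := ltP j 0; first by rewrite pq// mulr0.
by move: k0; rewrite -ij ltNge addr_ge0.
Qed.

Lemma laurent_pos1 : laurent_pos 1.
Proof. by move=> k k0; rewrite mcoeffU; case: eqP k0 => // <-. Qed.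

Lemma laurent_pos_divX p : laurent_pos p ->
  laurent_pos (mono 1 (-1) * p) <-> p@_0 = 0.
Proof.
move=> pp; split=> [/(_ (-1) isT)|p0 k k0].
  by rewrite laurentU_coefl subrr mul1r.
rewrite laurentU_coefl mul1r opprK.
have [/pp//|k1] := ltP (k + 1) 0.
by have -> : k + 1 = 0 by lia.
Qed.

Lemma laurent_coef0_mulX p : laurent_pos p -> (mono 1 1 * p)@_0 = 0.
Proof. by move=> pp; rewrite laurentU_coefl pp// mulr0. Qed.

(** Write [p = p_0 + t p''] with [p''] positive: the second summand contributes
    the coefficient of [t^-1] in [p'' q], which is zero. *)
Lemma laurent_coef0M p q : laurent_pos p -> laurent_pos q ->
  (p * q)@_0 = p@_0 * q@_0.
Proof.
move=> pp pq; set c : laurent R := mono p@_0 0.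
have cpos : laurent_pos (p - c).
  by move=> k k0; rewrite mcoeffB pp// mcoeffU; case: eqP k0 => [<-//|]; rewrite subr0.
have c0 : (p - c)@_0 = 0 by rewrite mcoeffB mcoeffUU subrr.
rewrite -{1}(subrK c p) mulrDl mcoeffD laurentU_coefl subr0 [X in X + _](_ : _ = 0) ?add0r//.
have -> : p - c = mono 1 1 * (mono 1 (-1) * (p - c)).
  by rewrite mulrA laurentUM mulr1 subrr mul1r.
rewrite -mulrA laurent_coef0_mulX//; apply: laurent_posM => //.
exact/laurent_pos_divX.
Qed.

Lemma laurent_bounded p : exists n : nat, laurent_pos (p * mono 1 (n%:Z)).
Proof.
suff [n nP] : exists n : nat, forall k, k < - n%:Z -> p@_k = 0.
  exists n => k k0; rewrite laurentU_coefr mulr1 nP//.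
  by rewrite ltrBlDr addNr.
elim/laurent_ind: p => [|p q [n nP] [m mP]|a i].
- by exists 0%N => k _; rewrite mcoeff0.
- exists (n + m)%N => k kl; rewrite mcoeffD nP ?mP ?addr0//.
    by rewrite (lt_le_trans kl)// PoszD opprD gerDr oppr_le0.
  by rewrite (lt_le_trans kl)// PoszD opprD gerDl oppr_le0.
exists `|i|%N => k kl; rewrite mcoeffU; case: eqP => // ik.
by exfalso; lia.
Qed.

End LaurentCoef.

(** * The pure paraunitary group as a Garside group *)

Section PPUGarside.
Variables (R : realType) (H : hilbertType R) (A : vonNeumannAlgebra H).
Local Notation X := (invSubspace (commutantVN A)).
Implicit Types (M L x y : X) (p q : PPU A).

Definition simple_laurent M : laurent (boundedOp H) := mono (1 - proj M) 0 + mono (proj M) 1.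

Lemma simple_star M :
  laurent_star (simple_laurent M) = mono (1 - proj M) 0 + mono (proj M) (-1).
Proof.
by rewrite laurent_starD !laurent_starU adjointB adjoint1 proj_adjoint oppr0.
Qed.

Lemma proj_compl M : [/\ (1 - proj M) * (1 - proj M) = 1 - proj M,
  (1 - proj M) * proj M = 0 & proj M * (1 - proj M) = 0].
Proof.
have PP := projK M.
have PQ : proj M * (1 - proj M) = 0 by rewrite mulrBr mulr1 PP subrr.
by split=> //; rewrite mulrBl mul1r ?PQ ?subr0// PP subrr.
Qed.

Fact simple_ppu M : is_ppu A (simple_laurent M).
Proof.
have [QQ QP PQ] := proj_compl M; have PP := projK M.
split.
- move=> k; rewrite mcoeffD !mcoeffU.
  have AP := proj_vn M; have AQ : vn_set A (1 - proj M).
    by rewrite -scaleN1r addrC; apply: vn_linear => //; exact: vn1.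
  by apply: vnD; case: eqP => _; rewrite ?mulr1n ?mulr0n//; exact: vn_zero.
- rewrite simple_star mulrDl !mulrDr !laurentUM QQ QP PQ PP !monalgU0.
  by rewrite !(addNr, addr0, add0r) -monalgUD subrK.
- rewrite simple_star mulrDl !mulrDr !laurentUM QQ QP PQ PP !monalgU0.
  by rewrite !(subrr, addr0, add0r) -monalgUD subrK.
- by rewrite laurent_sumD !laurent_sumU subrK.
Qed.

Definition ppu_simple M : PPU A := MkPPU (simple_ppu M).

Lemma ppu_valM p q : ppu_val (p * q)%g = ppu_val p * ppu_val q.
Proof. by []. Qed.

Lemma simple_coef0 M : (simple_laurent M)@_0 = 1 - proj M.
Proof. by rewrite mcoeffD !mcoeffU eqxx addr0. Qed.

Lemma ppu_simple_pos M : PPU_pos A (ppu_simple M).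
Proof.
move=> k; rewrite /= mcoeffD !mcoeffU.
by case: eqP => [<-//|_]; case: eqP => [<-//|_]; rewrite addr0.
Qed.

Lemma ppu_simple_additive : orth_additive ppu_simple.
Proof.
split=> [|x y xy]; apply: ppu_inj.
  by rewrite /= /simple_laurent proj_bot subr0 monalgU0 addr0.
rewrite ppu_valM /= /simple_laurent (proj_join xy).
have xy0 := proj_orth xy.
rewrite mulrDl !mulrDr !laurentUM xy0 monalgU0 addr0 !mulrBl !mulrBr !mul1r mulr1 xy0.
rewrite !subr0 !(addr0, add0r) -addrA -monalgUD; congr (mono _ 0 + mono _ 1).
  by rewrite opprD addrA addrAC.
exact: addrC.
Qed.

Local Notation t := (ppu_simple \top%O).

Lemma ppu_val_top : ppu_val t = mono 1 1.
Proof. by rewrite /= /simple_laurent proj_top subrr monalgU0 add0r. Qed.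

Lemma ppu_val_topV : ppu_val t^-1%g = mono 1 (-1).
Proof.
transitivity (laurent_star (ppu_val t)); first by [].
by rewrite ppu_val_top laurent_starU adjoint1.
Qed.

Lemma ppu_val_topX n : ppu_val (t ^+ n)%g = mono 1 n%:Z.
Proof.
elim: n => [//|n IH].
by rewrite expgS ppu_valM IH ppu_val_top laurentUM mulr1.
Qed.

Lemma ppu_topC p : commute p t.
Proof.
apply/ppu_inj/malgP => k; rewrite !ppu_valM ppu_val_top.
by rewrite laurentU_coefl laurentU_coefr mulr1 mul1r.
Qed.

Lemma ppu_posM p q : PPU_pos A p -> PPU_pos A q -> PPU_pos A (p * q)%g.
Proof. exact: laurent_posM. Qed.

Lemma ppu_coef0M p q : PPU_pos A p -> PPU_pos A q ->
  (ppu_val (p * q)%g)@_0 = (ppu_val p)@_0 * (ppu_val q)@_0.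
Proof. exact: laurent_coef0M. Qed.

Lemma ppu_pos1 : PPU_pos A 1%g.
Proof. exact: laurent_pos1. Qed.

(** If [p] and its inverse, which is its star, are both polynomials in [t], then
    [p] is constant, and a constant equals its sum of coefficients, 1. *)
Lemma ppu_pos_anti p : PPU_pos A p -> PPU_pos A p^-1%g -> p = 1%g.
Proof.
move=> pp pn; apply/ppu_inj.
have pE : ppu_val p = mono (ppu_val p)@_0 0.
  apply/malgP => k; rewrite mcoeffU; case: (ltgtP k 0) => [k0|k0|->//]; first exact: pp.
  apply: (can_inj (@adjointK _ _)); rewrite raddf0 -[k]opprK.
  rewrite -(laurent_star_coef (ppu_val p)); apply: pn; rewrite oppr_lt0//.
by have := ppu_pure (ppuP p); rewrite pE laurent_sumU => ->.
Qed.

Lemma ppu_pos_bounded p : exists n, PPU_pos A (p * t ^+ n)%g.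
Proof.
have [n pn] := laurent_bounded (ppu_val p); exists n.
by move=> k k0; rewrite ppu_valM ppu_val_topX; exact: pn.
Qed.

(** Constant coefficients decide divisibility by [t]; the two lemmas on division
    by [ppu_simple x] that follow reduce to this one. *)
Lemma ppu_pos_divl p : PPU_pos A p ->
  PPU_pos A (t^-1 * p)%g <-> (ppu_val p)@_0 = 0.
Proof.
by move=> pp; apply: iff_trans (laurent_pos_divX pp); rewrite -ppu_val_topV.
Qed.

Lemma ppu_simpleV x : ((ppu_simple x)^-1 = t^-1 * ppu_simple (ortho x))%g.
Proof.
by rewrite (orth_additive_top (ortho x) ppu_simple_additive) orthoK invgM mulgVK.
Qed.

Lemma simple_divides p x : PPU_pos A p ->
  PPU_pos A ((ppu_simple x)^-1 * p)%g <-> proj x * (ppu_val p)@_0 = 0.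
Proof.
move=> pp; have sp := ppu_simple_pos (ortho x).
rewrite ppu_simpleV -mulgA (ppu_pos_divl (ppu_posM sp pp)) (ppu_coef0M sp pp).
by rewrite simple_coef0 proj_ortho opprB addrC subrK.
Qed.

(** The quotient of [p] by [t * (ppu_simple x)^-1 = ppu_simple (ortho x)] on the
    right, written without inverses of [ppu_simple x]. *)
Lemma divides_simple_complement p x : PPU_pos A p ->
  PPU_pos A (t^-1 * (p * ppu_simple x))%g <-> (ppu_val p)@_0 * (1 - proj x) = 0.
Proof.
move=> pp; have sp := ppu_simple_pos x.
by rewrite (ppu_pos_divl (ppu_posM pp sp)) (ppu_coef0M pp sp) simple_coef0.
Qed.

Lemma coef0_topM p : PPU_pos A p -> (ppu_val (t * p)%g)@_0 = 0.
Proof. by move=> pp; rewrite ppu_valM ppu_val_top; exact: laurent_coef0_mulX. Qed.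

Lemma ppu_pos_topX n : PPU_pos A (t ^+ n)%g.
Proof.
elim: n => [|n IH]; first exact: ppu_pos1.
by rewrite expgS; exact: ppu_posM (ppu_simple_pos _) IH.
Qed.

(** By [simple_divides] and [le_nullspace1], this subspace is the largest [x]
    such that [ppu_simple x] divides [p] on the left. *)
Definition ppu_head p : X := nullspace A [set adjoint (ppu_val p)@_0].

Lemma ppu_garside : is_garside (PPU_pos A) ppu_simple ppu_head.
Proof.
split.
- exact: ppu_pos1.
- exact: ppu_posM.
- exact: ppu_pos_anti.
- exact: ppu_pos_bounded.
- exact: ppu_simple_additive.
- exact: ppu_simple_pos.
- move=> x /(congr1 (fun p => (ppu_val p)@_0)); rewrite simple_coef0 mcoeffUU.
  by move=> /eqP; rewrite subr_eq addrC -subr_eq subrr eq_sym => /eqP/proj_inj0.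
- exact: ppu_topC.
- move=> p x pp; rewrite (simple_divides x pp) le_nullspace1; first by [].
  by have [] := ppuP p.
- move=> p n pp; set a := (p^-1 * t ^+ n.+1)%g => ap.
  have -> : (((ppu_simple (ppu_head p))^-1 * p)^-1 * t ^+ n =
      t^-1 * (a * ppu_simple (ppu_head p)))%g.
    have -> : a = (t * (p^-1 * t ^+ n))%g by rewrite /a expgSr mulgA; exact: ppu_topC.
    rewrite invgM invgK -!mulgA mulKg; congr (_ * _)%g.
    exact: commuteX (ppu_topC _).
  apply: (divides_simple_complement _ ap).2.
  (* [a * p] and [p * a] both equal [t ^+ n.+1], since [t] is central. *)
  have ap0 : (ppu_val a)@_0 * (ppu_val p)@_0 = 0.
    rewrite -(ppu_coef0M ap pp) /a -mulgA -(commuteX _ (ppu_topC _)) mulKg expgS.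
    exact: coef0_topM (ppu_pos_topX n).
  rewrite mulrBr mulr1; apply/eqP; rewrite subr_eq0 eq_sym; apply/eqP.
  apply: (can_inj (@adjointK _ _)); rewrite adjointM proj_adjoint.
  apply: proj_nullspace_mul => c -> _.
  by rewrite -adjointM ap0 raddf0.
Qed.

End PPUGarside.

(** * Infima in the pure paraunitary group *)

Section PPULattice.
Variables (R : realType) (H : hilbertType R) (A : vonNeumannAlgebra H).
Local Notation X := (invSubspace (commutantVN A)).
Local Notation G := (PPU A).
Local Notation pos := (PPU_pos A).
Local Notation t := (ppu_simple (\top%O : X)).
Implicit Types (C : set G) (c g h k x : G).
Local Open Scope group_scope.

(** The elements [x] with [c * x] positive for all [c] in [C] form an ideal,
    closed under multiplication by positive elements on the right. For such an
    [x] the product [c * t ^+ n'.+1 * x] is a multiple of [t], so the constant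
    coefficient of [x] maps into the common kernel [M] of those of the elements
    [c * t ^+ n'.+1]. Hence [s] divides [x] on the left. Conversely [s * t ^+ n']
    belongs to the ideal, because the constant coefficient of [s] is the
    projection onto [M]. Dividing the ideal by [s] therefore gives one that
    contains [t ^+ n']. *)
Lemma common_multiples_principal n C :
  (forall x, (forall c, C c -> pos (c * x)) -> pos x) ->
  (forall c, C c -> pos (c * t ^+ n)) ->
  exists g, forall x, (forall c, C c -> pos (c * x)) <-> pos (g^-1 * x).
Proof.
elim: n C => [|n IH] C Cpos Ct.
  exists 1 => x; rewrite invg1 mul1g; split=> [/Cpos //|px c /Ct].
  by rewrite mulg1 => pc; exact: ppu_posM pc px.
pose a c := (ppu_val (c * t ^+ n.+1))@_0.
pose M : X := nullspace A [set a c | c in C].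
pose s : G := ppu_simple (ortho M).
have [x Cx|_ [c Cc <-]|g gP] := IH [set c * s | c in C].
- have py : pos (s * x).
    by apply: Cpos => c Cc; rewrite mulgA; apply: Cx; exists c.
  rewrite -[x](mulKg s); apply: (simple_divides _ py).2.
  rewrite proj_ortho mulrBl mul1r proj_nullspace_mul ?subrr// => _ [c Cc <-] _.
  have pcy : pos (c * (s * x)) by rewrite mulgA; apply: Cx; exists c.
  rewrite /a -(ppu_coef0M (Ct c Cc) py) -mulgA -(commuteX _ (ppu_topC _)) mulgA.
  rewrite (commuteX _ (ppu_topC _)) expgS -mulgA.
  exact: coef0_topM (ppu_posM (ppu_pos_topX A n) pcy).
- have -> : c * s * t ^+ n = t^-1 * (c * t ^+ n.+1 * s).
    have -> : c * t ^+ n.+1 = t * (c * t ^+ n) by rewrite expgSr mulgA; exact: ppu_topC.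
    by rewrite -!mulgA mulKg; congr (_ * _); exact: commuteX (ppu_topC _).
  apply: (divides_simple_complement _ (Ct c Cc)).2.
  rewrite proj_ortho opprB addrC subrK mul_proj_nullspace//; first by exists c.
  by have [] := ppuP (c * t ^+ n.+1).
exists (s * g) => x; rewrite invgM -mulgA -gP; split=> [Cx _ [c Cc <-]|Cx c Cc].
  by rewrite -mulgA mulVKg; exact: Cx.
by have := Cx (c * s) (ex_intro2 _ _ c Cc erefl); rewrite -mulgA mulVKg.
Qed.

Local Notation le := (cone_le pos).

Lemma ppu_lower_bound g h : exists l, le l g /\ le l h.
Proof.
have [n pn] := ppu_pos_bounded g; have [m pm] := ppu_pos_bounded h.
exists (t ^- (n + m)); rewrite /cone_le invgK; split.
  by rewrite expgnDr mulgA; exact: ppu_posM pn (ppu_pos_topX A m).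
by rewrite addnC expgnDr mulgA; exact: ppu_posM pm (ppu_pos_topX A n).
Qed.

Lemma ppu_upper_bound g h : exists k, le g k /\ le h k.
Proof.
have [n pn] := ppu_pos_bounded g^-1; have [m pm] := ppu_pos_bounded h^-1.
rewrite (commuteX _ (ppu_topC _)) in pn; rewrite (commuteX _ (ppu_topC _)) in pm.
exists (t ^+ (n + m)); rewrite /cone_le; split.
  by rewrite addnC expgnDr -mulgA; exact: ppu_posM (ppu_pos_topX A m) pn.
by rewrite expgnDr -mulgA; exact: ppu_posM (ppu_pos_topX A n) pm.
Qed.

(** [k] is a lower bound of [C] if and only if [c * k^-1] is positive for all [c]
    in [C]. After translation by [t ^- n], so that the elements [t ^+ n * k^-1]
    are positive, [common_multiples_principal] applies. *)
Lemma ppu_infimum C c0 l : C c0 -> (forall c, C c -> le l c) ->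
  exists m, forall k, (forall c, C c -> le k c) <-> le k m.
Proof.
move=> Cc0 lC; have [n pn] := ppu_pos_bounded c0^-1.
have [m pm] := ppu_pos_bounded l.
have [x Cx|_ [c Cc <-]|g gP] := @common_multiples_principal (n + m) [set c * t ^- n | c in C].
- have -> : x = c0^-1 * t ^+ n * (c0 * t ^- n * x).
    by rewrite (commuteX _ (ppu_topC _)) -!mulgA mulKg mulVKg.
  by apply: ppu_posM pn (Cx _ _); exists c0.
- by rewrite expgnDr mulgA mulgVK -[c](mulgVK l) -mulgA; exact: ppu_posM (lC c Cc) pm.
exists (g^-1 * t ^+ n) => k; rewrite {2}/cone_le -mulgA -gP.
split=> [kC _ [c Cc <-]|kC c Cc].
  by rewrite mulgA mulgVK; exact: kC.
by have := kC _ (ex_intro2 _ _ c Cc erefl); rewrite mulgA mulgVK.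
Qed.

Lemma ppu_le_refl g : le g g.
Proof. by rewrite /cone_le mulgV; exact: ppu_pos1. Qed.

Lemma ppu_right_lattice_order : is_right_lattice_order le.
Proof.
split.
- exact: ppu_le_refl.
- move=> g h gh hg; apply/esym/divg1_eq/(ppu_pos_anti gh).
  by rewrite invgM invgK.
- move=> g h k gh hk; rewrite /cone_le -[k](mulgVK h) -mulgA.
  exact: ppu_posM hk gh.
- by move=> g h k gh; rewrite /cone_le mulgKA.
- move=> g h; have [l [lg lh]] := ppu_lower_bound g h.
  have [|c [->|->]//|m mP] := @ppu_infimum [set c | c = g \/ c = h] g l; first by left.
  have mC := (mP m).2 (ppu_le_refl m).
  exists m; split; [by apply: mC; left|by apply: mC; right|].
  by move=> k kg kh; apply/mP => c [->|->].
move=> g h; have [k0 [gk hk]] := ppu_upper_bound g h.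
have [||m mP] := @ppu_infimum [set k | le g k /\ le h k] k0 g; first by split.
  by move=> c [].
exists m; split=> [||k gk' hk'].
- by apply/mP => c [].
- by apply/mP => c [].
by apply: (mP m).2 (ppu_le_refl m) _ _; split.
Qed.

End PPULattice.

(** * The isomorphism *)

Theorem theorem5 (R : realType) (H : hilbertType R) (A : vonNeumannAlgebra H)
    (G : groupType) (iota : invSubspace (commutantVN A) -> G)
    (structure_group_iota : is_structure_group iota) :
  is_right_lattice_order (cone_le (PPU_pos A)) /\
  exists f : {multiplicative PPU A -> G},
    bijective f /\
    forall p q : PPU A,
      cone_le (PPU_pos A) p q <->
      cone_le (generated_submonoid (range iota)) (f p) (f q).
Proof.
split; first exact: ppu_right_lattice_order.
have Gs := ppu_garside A.
have [f [g [fK gK fu]]] := structure_group_iso (garside_structure_group Gs) structure_group_iota.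
exists f; split=> [|p q]; first by exists g.
rewrite /cone_le -multiplicativeV -gmulfM (garside_cone_generated Gs).
split=> [|fpq]; first by apply: generated_submonoid_image => _ [x _ <-]; exists x; rewrite -?fu.
rewrite -[(q * p^-1)%g]fK; apply: generated_submonoid_image fpq => _ [x _ <-].
by exists x => //; rewrite -(fu x) /= fK.
Qed.
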